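(* Let $L=10^6$. Consider the following random subgraph $\mathcal{G}$ of the square lattice $\mathbb{Z}^2$ (with nearest-neighbour edges), depending on a parameter $\rho\in[0,1)$: keep all vertices; independently for every $i\in\mathbb{Z}$, with probability $\rho$ remove all vertical edges lying on the line $\{x=i\}$ (i.e. all edges $\{(i,j),(i,j+1)\}$, $j\in\mathbb{Z}$); independently for every $j\in\mathbb{Z}$ (and independently of the columns), with probability $\rho$ remove all horizontal edges lying on the line $\{y=j\}$ (i.e. all edges $\{(i,j),(i+1,j)\}$, $i\in\mathbb{Z}$). Conditionally on $\mathcal{G}$, perform Bernoulli bond percolation with parameter $p\in[0,1]$ on $\mathcal{G}$: each edge of $\mathcal{G}$ is open with probability $p$ and closed otherwise, independently. Let $\mathbb{P}$ denote the joint (annealed) law of the graph and the percolation. If $\rho\le L^{-16}$ and $p\ge (1-L^{-10})^{1/4}$, then $$\mathbb{P}\big[(0,0)\text{ is connected to infinity by an open path}\big]>0.$$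
   Context: ''$(0,0)$ is connected to infinity'' means that the open cluster of $(0,0)$ (the set of vertices joined to $(0,0)$ by a path of open edges of $\mathcal{G}$) is infinite. *)

(* Defs.v *)
From HB Require Import structures.
From mathcomp Require Import all_boot all_order all_algebra.
From mathcomp Require Import all_classical all_reals.
From mathcomp Require Import ereal topology normedtype sequences exp measure probability.
From Stdlib Require Import Relations.
Set Implicit Arguments. Unset Strict Implicit. Unset Printing Implicit Defensive.
Import Order.TTheory GRing.Theory Num.Theory.
Local Open Scope classical_set_scope.
Local Open Scope ring_scope.

Definition vertex := (int * int)%type.

(* Index set of the elementary Bernoulli variables:
   col i      : true = all vertical edges on the line {x = i} are removed   (prob rho)
   row j      : true = all horizontal edges on the line {y = j} are removed (prob rho)
   ev (i,j)   : percolation variable of the vertical edge {(i,j),(i,j+1)}   (open w.p. p)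
   eh (i,j)   : percolation variable of the horizontal edge {(i,j),(i+1,j)} (open w.p. p) *)
Definition idx := ((int + int) + (vertex + vertex))%type.
Definition col (i : int) : idx := inl (inl i).
Definition row (j : int) : idx := inl (inr j).
Definition ev (v : vertex) : idx := inr (inl v).
Definition eh (v : vertex) : idx := inr (inr v).

Section Model.
Variables (Omega : Type) (X : idx -> Omega -> bool).

Definition vopen (w : Omega) (v : vertex) : bool := ~~ X (col v.1) w && X (ev v) w.
Definition hopen (w : Omega) (v : vertex) : bool := ~~ X (row v.2) w && X (eh v) w.

Definition open_adj (w : Omega) (u v : vertex) : Prop :=
  (v = (u.1, u.2 + 1)%R /\ vopen w u) \/ (u = (v.1, v.2 + 1)%R /\ vopen w v) \/
  (v = (u.1 + 1, u.2)%R /\ hopen w u) \/ (u = (v.1 + 1, v.2)%R /\ hopen w v).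

Definition open_cluster (w : Omega) : set vertex :=
  [set v | clos_refl_trans vertex (open_adj w) (0, 0)%R v].

Definition conn_infty : set Omega := [set w | ~ finite_set (open_cluster w)].
End Model.

Definition mutually_independent {d} {T : measurableType d} {R : realType}
  (P : probability T R) (I : eqType) (Y : I -> T -> bool) : Prop :=
  forall (S : seq I) (b : I -> bool), uniq S ->
    P [set w | all (fun i => Y i w == b i) S] =
    (\prod_(i <- S) P [set w | Y i w = b i])%E.

Definition annealed_model {d} {T : measurableType d} {R : realType}
  (P : probability T R) (rho p : R) (X : idx -> T -> bool) : Prop :=
  [/\ forall k, measurable (X k @^-1` [set true]),
      mutually_independent P X &
    [/\ forall i, P (X (col i) @^-1` [set true]) = rho%:E,
      forall j, P (X (row j) @^-1` [set true]) = rho%:E,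
      forall v, P (X (ev v) @^-1` [set true]) = p%:E &
      forall v, P (X (eh v) @^-1` [set true]) = p%:E]].

Definition bigL {R : realType} : R := 10%:R ^+ 6.

(* Main.v *)
Require Import Defs.
From HB Require Import structures.
From mathcomp Require Import all_boot all_order all_algebra.
From mathcomp Require Import all_classical all_reals.
From mathcomp Require Import ereal topology normedtype sequences exp measure probability.
From mathcomp Require Import ring lra zify.
From Stdlib Require Import Relations.
Import Order.TTheory GRing.Theory Num.Theory.
Local Open Scope classical_set_scope.
Local Open Scope ring_scope.

(* Group columns, and likewise rows, into blocks of L, L^2, L^3, ... lines.  A
   removed line has weight 1; a block with at most one sub-block of non-zero
   weight inherits that weight minus 1, and a block with several of them gets
   the sum of their weights plus a penalty for each.  Discounting one unit per
   level costs a factor 1/z in the moment E[z^weight; weight > 0] against a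
   factor L for the number of sub-blocks, so these moments decay geometrically
   and with positive probability all the blocks [0, L^n) have weight 0.

   Fix such an environment.  Crossing, inside a transversal block of weight 0, a
   run of consecutive blocks of non-zero weight has probability at least
   1 / ((1 + defect n) (1 + amp n (2^E - 1))), where the cost E is linear in the
   weights and amp n = A0 / 16^n.  Indeed, a level-(n+1) crossing succeeds as
   soon as one of at least L - 1 independent level-n lines does.  By Harris'
   inequality a line succeeds with probability at least 1 / (1 + T), where T
   involves the level-n cost, which exceeds the level-(n+1) cost by a bounded
   amount only; by Bernoulli's inequality L - 1 attempts turn T into T / (L - 1),
   which more than compensates this excess.  Two independent lines of a block
   of weight 0 are unlikely to fail simultaneously, so such a block is well
   connected except with probability of order amp n ^ 2.

   Hence the lines [0, L^(n+1)) x [0, L^n) are all crossed with positive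
   probability, and their crossings are linked to each other at the origin. *)

Set Implicit Arguments. Unset Strict Implicit. Unset Printing Implicit Defensive.

(** * Expectation over finitely many Bernoulli coordinates *)

Section FiniteExpectation.
Variables (R : realFieldType) (K : eqType) (pr : K -> R).
Hypothesis pr01 : forall k, 0 <= pr k <= 1.
Implicit Types (w : K -> bool) (f g : (K -> bool) -> R) (e : (K -> bool) -> bool).
Implicit Types (A : pred K) (S : seq K).

Definition upd w k b : K -> bool := fun k' => if k' == k then b else w k'.

(* Integrates out the coordinates in S; the others stay frozen at w. *)
Fixpoint ex S f w : R :=
  if S is k :: S' then
    pr k * ex S' f (upd w k true) + (1 - pr k) * ex S' f (upd w k false)
  else f w.

Definition Pr S e w : R := ex S (fun w' => (e w')%:R) w.

Definition le_cfg w w' := forall k, w k -> w' k.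
Definition increasing f := forall w w', le_cfg w w' -> f w <= f w'.
Definition increasing_event e := forall w w', le_cfg w w' -> e w -> e w'.
Definition depends_on A T (h : (K -> bool) -> T) :=
  forall w w', (forall k, A k -> w k = w' k) -> h w = h w'.

Lemma upd_out w k b k' : k' != k -> upd w k b k' = w k'.
Proof. by rewrite /upd => /negbTE ->. Qed.

Lemma ex_cat S1 S2 f w : ex (S1 ++ S2) f w = ex S1 (ex S2 f) w.
Proof. by elim: S1 w => [|k S1 IH] w //=; rewrite !IH. Qed.

Lemma ex_le_in S f g w :
  (forall w', (forall k, k \notin S -> w' k = w k) -> f w' <= g w') ->
  ex S f w <= ex S g w.
Proof.
elim: S w => [|k S IH] w h /=; first exact: h.
have /andP[p0 p1] := pr01 k.
have hb b : ex S f (upd w k b) <= ex S g (upd w k b).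
  apply: IH => w' hw'; apply: h => k'.
  by rewrite inE negb_or => /andP[kk' kS]; rewrite hw' // upd_out.
by rewrite lerD // ler_wpM2l // subr_ge0.
Qed.

Lemma ex_le S f g w : (forall w', f w' <= g w') -> ex S f w <= ex S g w.
Proof. by move=> h; apply: ex_le_in. Qed.

Lemma ex_ext_in S f g w :
  (forall w', (forall k, k \notin S -> w' k = w k) -> f w' = g w') ->
  ex S f w = ex S g w.
Proof.
move=> h; apply: le_anti; apply/andP.
by split; apply: ex_le_in => w' hw'; rewrite h.
Qed.

Lemma ex_ext S f g w : (forall w', f w' = g w') -> ex S f w = ex S g w.
Proof. by move=> h; apply: ex_ext_in. Qed.

Lemma ex_cst S c w : ex S (fun=> c) w = c.
Proof. by elim: S w => [|k S IH] w //=; rewrite !IH; ring. Qed.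

Lemma exD S f g w : ex S (fun w => f w + g w) w = ex S f w + ex S g w.
Proof. by elim: S w => [|k S IH] w //=; rewrite !IH; ring. Qed.

Lemma exZ S c f w : ex S (fun w => c * f w) w = c * ex S f w.
Proof. by elim: S w => [|k S IH] w //=; rewrite !IH; ring. Qed.

Lemma exN S f w : ex S (fun w => - f w) w = - ex S f w.
Proof. by elim: S w => [|k S IH] w //=; rewrite !IH; ring. Qed.

Lemma ex_sum S I (r : seq I) (P : pred I) (F : I -> (K -> bool) -> R) w :
  ex S (fun w => \sum_(i <- r | P i) F i w) w = \sum_(i <- r | P i) ex S (F i) w.
Proof.
elim: r => [|i r IH].
  rewrite big_nil (@ex_ext _ _ (fun=> 0)) ?ex_cst // => w'; exact: big_nil.
rewrite big_cons -IH; case: ifP => Pi; last first.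
  by apply: ex_ext => w'; rewrite big_cons Pi.
by rewrite -exD; apply: ex_ext => w'; rewrite big_cons Pi.
Qed.

Lemma ex_ge0 S f w : (forall w', 0 <= f w') -> 0 <= ex S f w.
Proof. by move=> h; rewrite -(ex_cst S 0 w); apply: ex_le. Qed.

Lemma ex_coord S (F : bool -> R) k w :
  ex S (fun w => F (w k)) w =
  if k \in S then pr k * F true + (1 - pr k) * F false else F (w k).
Proof.
elim: S w => [|k' S IH] w //=; rewrite !IH inE.
case: (k \in S); first by rewrite orbT; ring.
by rewrite orbF /upd; case: eqVneq => [->|_] //; ring.
Qed.

Lemma ex_agree S f A w w' : depends_on A f ->
  (forall k, A k -> k \notin S -> w k = w' k) -> ex S f w = ex S f w'.
Proof.
move=> df; elim: S w w' => [|k S IH] w w' h /=.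
  by apply: df => k Ak; apply: h.
have hb b : ex S f (upd w k b) = ex S f (upd w' k b).
  apply: IH => k' Ak' k'S; rewrite /upd; case: eqVneq => // kk'.
  by apply: h; rewrite // inE negb_or kk'.
by rewrite !hb.
Qed.

(** Induction on [S]: each integrated coordinate lies in [A] or not, so only one of the two factors
    sees it and the other comes out of the sum. *)
Lemma ex_mul_indep S f g A w :
  depends_on A f -> depends_on (predC A) g ->
  ex S (fun w => f w * g w) w = ex S f w * ex S g w.
Proof.
move=> df dg; elim: S w => [|k S IH] w //=; rewrite !IH.
have [Ak|nAk] := boolP (A k).
  have hb b : ex S g (upd w k b) = ex S g w.
    apply: ex_agree dg _ => k' /= nAk' _; apply: upd_out.
    by apply: contraNneq nAk' => ->.
  by rewrite !hb; ring.
have hb b : ex S f (upd w k b) = ex S f w.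
  apply: ex_agree df _ => k' /= Ak' _; apply: upd_out.
  by apply: contraNneq nAk => <-.
by rewrite !hb; ring.
Qed.

Lemma ex_prod_indep (J : eqType) (s : seq J) (F : J -> (K -> bool) -> R)
    (A : J -> pred K) S w :
  uniq s -> (forall j, depends_on (A j) (F j)) ->
  (forall j j' k, j \in s -> j' \in s -> A j k -> A j' k -> j = j') ->
  ex S (fun w => \prod_(j <- s) F j w) w = \prod_(j <- s) ex S (F j) w.
Proof.
move=> us dF; elim: s us => [|j s IH] /= us dA.
  by rewrite big_nil (@ex_ext _ _ (fun=> 1)) ?ex_cst // => w'; rewrite big_nil.
move/andP: us => [js us]; rewrite big_cons -IH //; last first.
  by move=> j1 j2 k h1 h2; apply: dA; rewrite inE ?h1 ?h2 orbT.
rewrite -(@ex_mul_indep _ _ _ (A j)) //.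
  by apply: ex_ext => w'; rewrite big_cons.
move=> w1 w2 h; apply: eq_big_seq => j' j's; apply: dF => k Ak; apply: h.
apply/negP => Ajk; suff E : j = j' by move: js; rewrite E j's.
by apply: (dA _ _ k); rewrite ?inE ?eqxx ?j's ?orbT.
Qed.

Lemma increasing_ex S f : increasing f -> increasing (ex S f).
Proof.
move=> mf; elim: S => [|k S IH] w w' h /=; first exact: mf.
have /andP[p0 p1] := pr01 k.
have hb b : ex S f (upd w k b) <= ex S f (upd w' k b).
  by apply: IH => k'; rewrite /upd; case: ifP => // _; apply: h.
by rewrite lerD // ler_wpM2l // subr_ge0.
Qed.

(** Induction on the coordinates. For a single one, the two sides differ by [p (1 - p)] times the
    product of the increments of [f] and [g], both non-negative. *)
Lemma harris S f g w : increasing f -> increasing g ->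
  ex S f w * ex S g w <= ex S (fun w => f w * g w) w.
Proof.
move=> mf mg; elim: S w => [|k S IH] w //=.
have /andP[p0 p1] := pr01 k.
have q0 : 0 <= 1 - pr k by rewrite subr_ge0.
apply: (le_trans _ (lerD (ler_wpM2l p0 (IH _)) (ler_wpM2l q0 (IH _)))).
have up : le_cfg (upd w k false) (upd w k true).
  by move=> k'; rewrite /upd; case: ifP.
have hf := increasing_ex S mf up; have hg := increasing_ex S mg up.
move: hf hg.
set a := ex S f _; set b := ex S f _; set c := ex S g _; set d := ex S g _ => hf hg.
have : 0 <= pr k * (1 - pr k) * ((b - a) * (d - c)).
  by rewrite !mulr_ge0 // subr_ge0.
by rewrite -subr_ge0 => h; rewrite -subr_ge0; apply: le_trans h _; lra.
Qed.

Lemma increasing_ind e : increasing_event e -> increasing (fun w => (e w)%:R).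
Proof.
move=> me w w' h; have := me w w' h.
by case: (e w) => [->|_] //; rewrite ler0n.
Qed.

Lemma Pr_ge0 S e w : 0 <= Pr S e w.
Proof. by apply: ex_ge0 => w'; rewrite ler0n. Qed.

Lemma Pr_and_ge S e1 e2 w : increasing_event e1 -> increasing_event e2 ->
  Pr S e1 w * Pr S e2 w <= Pr S (fun w => e1 w && e2 w) w.
Proof.
move=> m1 m2; apply: le_trans (harris _ _ (increasing_ind m1) (increasing_ind m2)) _.
by apply: ex_le => w'; case: (e1 w'); case: (e2 w'); rewrite ?mulr1 ?mul0r ?mulr0.
Qed.

Lemma PrC S e w : Pr S (fun w => ~~ e w) w = 1 - Pr S e w.
Proof.
rewrite -[1 in RHS](ex_cst S 1 w) -exN -exD; apply: ex_ext => w'.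
by case: (e w'); rewrite ?subrr ?subr0.
Qed.

Lemma Pr_le S e1 e2 w : (forall w', e1 w' -> e2 w') -> Pr S e1 w <= Pr S e2 w.
Proof. by move=> h; apply: ex_le => w'; have := h w'; case: (e1 w') => [->|_] //; rewrite ler0n. Qed.

Lemma Pr_sure S e w : (forall w', e w') -> Pr S e w = 1.
Proof. by move=> h; rewrite -[RHS](ex_cst S 1 w); apply: ex_ext => w'; rewrite h. Qed.

Lemma Pr_le1 S e w : Pr S e w <= 1.
Proof. by rewrite -(ex_cst S 1 w); apply: ex_le => w'; rewrite lern1 leq_b1. Qed.

End FiniteExpectation.

(** * Weights of blocks of lines *)

Section Weights.
Local Open Scope nat_scope.

(** The 5 covers the largest surcharge in [cost]: 1 for the bad block itself and 4 for a bad
    predecessor. *)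
Definition penalized (w : nat) : nat := if w == 0 then 0 else w + 5.

Definition merge (ws : seq nat) : nat :=
  if count (fun w => 0 < w) ws <= 1 then (sumn ws).-1
  else sumn (map penalized ws).

Fixpoint wt (L : nat) (a : nat -> bool) n i : nat :=
  if n is n'.+1 then merge (map (wt L a n') (iota (i * L) L)) else a i.

(* The resistance of a run grows like 2 ^ cost: weight + 1 for each bad block,
   and 4 more when the block before it (b for the first one) is bad too. *)
Fixpoint cost (b : bool) (ws : seq nat) : nat :=
  if ws is w :: ws' then
    if w is 0 then cost false ws' else w.+1 + 4 * b + cost true ws'
  else 0.

Definition endbad b (ws : seq nat) : bool := last b (map (fun w => 0 < w) ws).

Lemma cost_cat b ws1 ws2 :
  cost b (ws1 ++ ws2) = cost b ws1 + cost (endbad b ws1) ws2.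
Proof.
rewrite /endbad; elim: ws1 b => [|[|w] ws1 IH] b //=; rewrite ?IH //.
by rewrite addnA.
Qed.

Lemma endbad_cat b ws1 ws2 : endbad b (ws1 ++ ws2) = endbad (endbad b ws1) ws2.
Proof. by rewrite /endbad map_cat last_cat. Qed.

Lemma cost_le_penalized b ws : cost b ws <= sumn (map penalized ws).
Proof.
elim: ws b => [|[|w] ws IH] b //=.
rewrite /penalized /= leq_add //; case: b; lia.
Qed.

Lemma count_bad0 b ws : count (fun w => 0 < w) ws = 0 ->
  [/\ cost b ws = 0, sumn ws = 0 & endbad b ws -> ws = [::]].
Proof.
rewrite /endbad; elim: ws b => [|[|w] ws IH] b //= h.
have [-> -> h3] := IH false h; split => //.
by move=> h4; have E := h3 h4; move: h4; rewrite E.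
Qed.

(* A block ending badly prepays, through the term endbad, half of the surcharge
   4 of an adjacent bad sub-block in the next block. *)
Lemma cost_merge b ws : 1 < size ws ->
  cost b ws + 2 * endbad b ws <= merge ws + 4 + 2 * b.
Proof.
rewrite /merge; case: (leqP (count _ ws) 1) => [h1|_ _]; last first.
  have := cost_le_penalized b ws; case: (endbad b ws) => /=; lia.
have nofirst ws' : count (fun w => 0 < w) ws' <= 1 ->
    cost false ws' + 2 * endbad false ws' <= (sumn ws').-1 + 4.
  elim: ws' => [|[|w] ws' IH] //= h.
  have h0 : count (fun w => 0 < w) ws' = 0 by lia.
  have [-> -> _] := count_bad0 true h0.
  by rewrite /endbad; case: (last _ _) => /=; lia.
case: b => /=; last by have := nofirst _ h1; lia.
case: ws h1 => [|[|w] ws] //= h1 hs; first by have := nofirst _ h1; rewrite /endbad /=; lia.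
have h0 : count (fun w => 0 < w) ws = 0 by lia.
have [-> -> h] := count_bad0 true h0.
have -> : endbad true (w.+1 :: ws) = false.
  by apply/negP => /h E; move: hs; rewrite E.
lia.
Qed.

Lemma cost_all_bad b ws : all (fun w => 0 < w) ws ->
  cost b ws + 4 * (0 < size ws) = sumn (map (fun w => w + 5) ws) + 4 * (b && (0 < size ws)).
Proof.
elim: ws b => [|[|w] ws IH] b //= h; first by rewrite andbF.
have := IH true h; case: b; case: ws h {IH} => [|w' ws'] /=; lia.
Qed.

(** * Comparison of the costs at two successive levels *)

Section Blocks.
Variables (L : nat) (v v' : nat -> nat).
Hypothesis L2 : 1 < L.
Hypothesis v'E : forall i, v' i = merge (map v (iota (i * L) L)).

(** [cost_merge] is summed over the blocks; the [endbad] terms telescope, since the final flag of a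
    block is the initial flag of the next. *)
Lemma cost_blocks b i r :
  cost b (map v (iota (i * L) (r * L))) +
    2 * endbad b (map v (iota (i * L) (r * L))) <=
  sumn (map (fun k => v' k + 4) (iota i r)) + 2 * b.
Proof.
elim: r i b => [|r IH] i b; first by rewrite mul0n.
rewrite mulSn iotaD map_cat cost_cat endbad_cat /= v'E.
set b1 := endbad b _.
have := @cost_merge b (map v (iota (i * L) L)).
rewrite size_map size_iota => /(_ L2); rewrite -/b1.
have := IH i.+1 b1; rewrite mulSn (addnC L) /=; lia.
Qed.

(* i and i + r + 1 are consecutive good blocks of the coarse level; the range
   runs from the start of the former to the end of the latter. *)
Lemma cost_range i r :
  v' i = 0 -> v' (i + r).+1 = 0 -> all (fun w => 0 < w) (map v' (iota i.+1 r)) ->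
  cost false (map v (iota (i * L) (r.+2 * L))) + r
    <= cost false (map v' (iota i.+1 r)) + 12.
Proof.
move=> vi vj bad.
have E : iota i r.+2 = i :: iota i.+1 r ++ [:: (i + r).+1].
  rewrite -[r.+2]add1n (iotaD i 1) addn1; congr cons; by rewrite -(addn1 r) (iotaD i.+1) addSn.
have := cost_blocks false i r.+2; set ws := map v _.
rewrite E map_cons map_cat /= sumn_cat /= vi vj.
(* At the coarse level a bad block of weight [w] costs [w + 5], except the first, which costs 4
   less; [cost_blocks] charges only [w + 4]. This gives the gain [r]; the 12 is this 4 plus 4 for
   each good end block. *)
have := cost_all_bad false bad; rewrite size_map size_iota /=.
have -> : sumn (map (fun w => w + 5) (map v' (iota i.+1 r))) =
  sumn (map (fun k => v' k + 4) (iota i.+1 r)) + r.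
  by elim: r i.+1 {ws bad vj E} => //= r IH k; rewrite IH; lia.
move: (cost _ ws) (endbad _ ws) => x y; case: r {ws bad vj E} => [|r] /=; lia.
Qed.

Lemma cost_good_block i : v' i = 0 -> cost false (map v (iota (i * L) L)) <= 4.
Proof. by move=> vi; have := cost_blocks false i 1; rewrite mul1n /= vi; lia. Qed.

(** Two bad sub-blocks would each contribute a positive penalized weight, so a block of weight 0 has
    at most one. *)
Lemma count_good_block i : v' i = 0 ->
  L.-1 <= size [seq k <- iota (i * L) L | v k == 0].
Proof.
have := count_predC (fun k => v k == 0) (iota (i * L) L).
rewrite size_iota v'E /merge size_filter count_map; set s := iota _ _.
have -> : count (predC (fun k => v k == 0)) s = count (preim v (fun w => 0 < w)) s.
  by apply: eq_count => k /=; rewrite lt0n.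
set c := count (preim _ _) s; case: (leqP c 1) => c2 cE pen0; first lia.
exfalso.
suff : c <= sumn (map penalized (map v s)) by lia.
rewrite /c; elim: s {c c2 cE pen0} => //= k s IH; rewrite leq_add //.
by rewrite /penalized; case: (v k).
Qed.
End Blocks.

End Weights.

Section WeightSupport.
Variables (K : eqType) (c : nat -> K) (L : nat).
Hypothesis L0 : (0 < L)%N.

Definition cblock n i : pred K := fun x => has (fun k => x == c k) (iota (i * L ^ n) (L ^ n)).

Lemma wt_depends n i : depends_on (cblock n i) (fun w => wt L (w \o c) n i).
Proof.
move=> w w'; elim: n i => [|n IH] i h /=.
  by rewrite h // /cblock /= muln1 eqxx.
congr merge; apply/eq_in_map => k; rewrite mem_iota => hk.
apply: IH => x /hasP[m]; rewrite mem_iota => hm /eqP ->; apply: h.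
apply/hasP; exists m => //; rewrite mem_iota expnS mulnA.
by have : (0 < L ^ n)%N by [rewrite expn_gt0 L0]; nia.
Qed.

End WeightSupport.

(** * Exponential moments of the weights *)

Section Moments.
Variable R : realFieldType.

(** The integrand of the truncated moment E[z^m; m > 0]; for [z >= 1] it dominates the indicator of
    [m != 0]. *)
Definition zpow (z : R) (m : nat) : R := if m == 0%N then 0 else z ^+ m.

Lemma zpow_ge0 z m : 0 <= z -> 0 <= zpow z m.
Proof. by rewrite /zpow => z0; case: ifP => // _; rewrite exprn_ge0. Qed.

Lemma prod1D_ge (ys : seq R) : (forall y, y \in ys -> 0 <= y) ->
  1 + \sum_(y <- ys) y <= \prod_(y <- ys) (1 + y).
Proof.
elim: ys => [|y ys IH] h; first by rewrite !big_nil addr0.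
have y0 : 0 <= y by apply: h; rewrite mem_head.
have IH' := IH (fun y' h' => h _ (@mem_behead _ (y :: ys) _ h')).
have s0 : 0 <= \sum_(y <- ys) y.
  by rewrite big_seq sumr_ge0 // => y' h'; apply: h; rewrite inE h' orbT.
rewrite !big_cons; nra.
Qed.

(** With two factors or more, the full product is a term of the expansion distinct from the linear
    ones. *)
Lemma prod1D_ge_pair (ys : seq R) : (1 < size ys)%N -> (forall y, y \in ys -> 0 <= y) ->
  1 + \sum_(y <- ys) y + \prod_(y <- ys) y <= \prod_(y <- ys) (1 + y).
Proof.
elim: ys => [|y ys IH] //= hs h.
have y0 : 0 <= y by apply: h; rewrite mem_head.
have h' y' : y' \in ys -> 0 <= y' by move=> h'; apply: h; rewrite inE h' orbT.
have s0 : 0 <= \sum_(y <- ys) y by rewrite big_seq sumr_ge0.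
have p0 : 0 <= \prod_(y <- ys) y by rewrite big_seq prodr_ge0.
case: ys IH hs h' s0 p0 {h} => [|y1 [|y2 ys]] // IH _ h' s0 p0.
  by rewrite !big_cons !big_nil; lra.
have := IH isT h'; rewrite !(big_cons _ _ y (y1 :: y2 :: ys)).
set s := \sum_(y <- _) y in s0 *; set p := \prod_(y <- _) y in p0 *.
set q := \prod_(y <- _) (1 + y) => hq; nra.
Qed.

(** Bounds the terms of degree at least two. Adding a factor [1 + x] adds [x (P - 1)] to them, where
    [P - 1 <= 2 n e] by the induction hypothesis. *)
Lemma prod1D_le (e : R) (es : seq R) : 0 <= e -> (size es)%:R * e <= 1 ->
  (forall x, x \in es -> 0 <= x <= e) ->
  \prod_(x <- es) (1 + x) - 1 - \sum_(x <- es) x <= ((size es)%:R * e) ^+ 2.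
Proof.
move=> e0; elim: es => [|x es IH] /= hs h; first by rewrite !big_nil mul0r expr0n /= subrr subr0.
have /andP[x0 xe] : 0 <= x <= e by apply: h; rewrite mem_head.
have h' y : y \in es -> 0 <= y <= e by move=> hy; apply: h; rewrite inE hy orbT.
have hn : (size es).+1%:R = (size es)%:R + 1 :> R by rewrite -natr1.
rewrite hn in hs *; set n : R := (size es)%:R in hs IH *.
have n0 : 0 <= n by rewrite ler0n.
have ne0 : 0 <= n * e by rewrite mulr_ge0.
have hs' : n * e <= 1 by lra.
have hsum : \sum_(x <- es) x <= n * e.
  rewrite /n; elim: es h' {IH hs h hn n n0 ne0 hs'} => [|y es IH] h' /=.
    by rewrite big_nil mul0r.
  rewrite big_cons -natr1 mulrDl mul1r addrC lerD ?IH //.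
    by move=> y' hy; apply: h'; rewrite inE hy orbT.
  by have /andP[] := h' y (mem_head _ _).
have {}IH := IH hs' h'.
rewrite !big_cons; set P := \prod_(x <- es) _ in IH *; set Q := \sum_(x <- es) x in IH hsum *.
have hP : P - 1 <= 2 * (n * e) by nra.
have : x * (P - 1) <= 2 * (n * e) * e.
  apply: (le_trans (y := x * (2 * (n * e)))); first by rewrite ler_wpM2l.
  by rewrite mulrC ler_wpM2l // mulr_ge0.
nra.
Qed.

(* The second term is the sum of the products of the z ^+ 5 * zpow z w over at
   least two sub-blocks. *)
Lemma zpow_merge (z : R) ws : 1 <= z ->
  zpow z (merge ws) <= z^-1 * \sum_(w <- ws) zpow z w +
   (\prod_(w <- ws) (1 + z ^+ 5 * zpow z w) - 1 - \sum_(w <- ws) z ^+ 5 * zpow z w).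
Proof.
move=> z1; have z0 : 0 < z by lra.
have zi0 : 0 <= z^-1 by rewrite invr_ge0 ltW.
have y0 w : 0 <= z ^+ 5 * zpow z w by rewrite mulr_ge0 ?zpow_ge0 ?exprn_ge0 // ltW.
have s0 (ws' : seq nat) : 0 <= \sum_(w <- ws') zpow z w.
  by rewrite sumr_ge0 // => w _; rewrite zpow_ge0 // ltW.
have /= pge := @prod1D_ge [seq z ^+ 5 * zpow z w | w <- ws].
rewrite !big_map in pge.
have {}pge : 0 <= \prod_(w <- ws) (1 + z ^+ 5 * zpow z w) - 1 - \sum_(w <- ws) z ^+ 5 * zpow z w.
  by rewrite -addrA -opprD subr_ge0; apply: pge => y /mapP[w _ ->].
rewrite /merge; case: (leqP (count _ ws) 1%N) => hc.
  (* A lone bad sub-block passes on its weight minus 1, whence the factor [z^-1]. *)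
  rewrite -[leLHS]addr0; apply: lerD => //.
  elim: ws hc {pge} => [|[|w] ws IH] /= hc; first by rewrite /zpow eqxx big_nil mulr0.
    by rewrite big_cons /zpow /= add0r; apply: IH.
  have h0 : count (fun w => (0 < w)%N) ws = 0%N by lia.
  have [_ -> _] := count_bad0 true h0; rewrite addn0 big_cons mulrDr.
  apply: (le_trans (y := z^-1 * zpow z w.+1)); last by rewrite lerDl mulr_ge0.
  rewrite /zpow /= exprS (mulKf (lt0r_neq0 z0)); case: ifP => // _; exact: exprn_ge0 (ltW z0).
apply: (le_trans (y := \prod_(w <- ws) (1 + z ^+ 5 * zpow z w) - 1 - \sum_(w <- ws) z ^+ 5 * zpow z w));
  last by rewrite lerDr mulr_ge0.
(* With several bad sub-blocks, the product over all of them is [z ^+ sumn (map penalized ws)], and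
   [prod1D_ge_pair] finds it among the terms of degree at least two. *)
pose bad := [seq w <- ws | (0 < w)%N].
have pairs := @prod1D_ge_pair [seq z ^+ 5 * zpow z w | w <- bad].
have bad0 y : y \in [seq z ^+ 5 * zpow z w | w <- bad] -> 0 <= y.
  by case/mapP=> w _ ->.
rewrite size_map size_filter !big_map in pairs.
have {pairs} := pairs hc bad0; rewrite !big_filter.
have -> : \sum_(w <- ws | (0 < w)%N) z ^+ 5 * zpow z w = \sum_(w <- ws) z ^+ 5 * zpow z w.
  rewrite big_mkcond /=; apply: eq_bigr => w _; case: w => //=; by rewrite /zpow /= mulr0.
have -> : \prod_(w <- ws | (0 < w)%N) (1 + z ^+ 5 * zpow z w) = \prod_(w <- ws) (1 + z ^+ 5 * zpow z w).
  rewrite big_mkcond /=; apply: eq_bigr => w _; case: w => //=; by rewrite /zpow /= mulr0 addr0.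
have -> : \prod_(w <- ws | (0 < w)%N) (z ^+ 5 * zpow z w) = z ^+ sumn (map penalized ws).
  elim: ws {hc pge bad bad0} => [|[|w] ws IH] /=; first by rewrite big_nil expr0.
    by rewrite big_cons /= IH.
  rewrite big_cons /= IH /zpow /penalized /= -!exprD; congr (_ ^+ _); lia.
have -> : zpow z (sumn (map penalized ws)) = z ^+ sumn (map penalized ws).
  rewrite /zpow; case: eqP => // E0; exfalso.
  move: hc E0; elim: ws {pge bad bad0} => [|[|w] ws IH] //=.
lra.
Qed.

Variables (K : eqType) (pr : K -> R) (c : nat -> K) (L : nat) (z eps : R).
Hypothesis pr01 : forall k, 0 <= pr k <= 1.
Hypothesis c_inj : injective c.
Hypothesis z1 : 1 <= z.
Hypothesis prz : forall i, pr (c i) * z <= eps.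
Hypothesis Lz : L%:R <= z / 4.
Hypothesis eps_small : (L%:R * z ^+ 5) ^+ 2 * eps <= 1 / 4.
Hypothesis L0 : (0 < L)%N.

(** If [e] bounds the moment at one level, [zpow_merge] and the independence of disjoint blocks
    bound the next one by [L e / z + (L z^5 e)^2]. [Lz] and [eps_small] make each term at most
    [e / 4]. *)
Lemma moment_bound S w0 : (forall i, w0 (c i) = false) ->
  forall n i, ex pr S (fun w => zpow z (wt L (w \o c) n i)) w0 <= eps / 2 ^+ n.
Proof.
move=> w00; have z0 : 0 < z := lt_le_trans ltr01 z1.
have e0 : 0 <= eps.
  have /andP[p0 _] := pr01 (c 0%N).
  by apply: le_trans (prz 0%N); rewrite mulr_ge0 // ltW.
elim=> [|n IH] i.
  (* A line outside [S] is frozen as not removed and has moment 0. *)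
  rewrite (@ex_ext _ _ _ pr01 _ _ (fun w => zpow z (w (c i)))) => [|w'] //.
  rewrite (ex_coord _ _ (fun b : bool => zpow z b)) w00 /zpow /= !expr1 mulr0 addr0 divr1.
  by case: ifP.
set en := eps / 2 ^+ n in IH *.
have en0 : 0 <= en by rewrite divr_ge0 // exprn_ge0.
have ene : en <= eps.
  rewrite ler_pdivrMr ?exprn_gt0 // ler_peMr // exprn_ege1 //; lra.
set s := iota (i * L) L.
pose F k (w : K -> bool) := zpow z (wt L (w \o c) n k).
have F0 k w : 0 <= F k w by rewrite zpow_ge0 // ltW.
apply: (le_trans (y := ex pr S (fun w => z^-1 * \sum_(k <- s) F k w +
    ((\prod_(k <- s) (1 + z ^+ 5 * F k w) - 1) + - \sum_(k <- s) z ^+ 5 * F k w)) w0)).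
  apply: ex_le => // w; have := zpow_merge (map (wt L (w \o c) n) s) z1.
  by rewrite !big_map.
rewrite !exD exZ exN !ex_sum // ex_cst.
have indep : ex pr S (fun w => \prod_(k <- s) (1 + z ^+ 5 * F k w)) w0 =
   \prod_(k <- s) (1 + z ^+ 5 * ex pr S (F k) w0).
  rewrite (@ex_prod_indep _ _ _ pr01 _ _ _ (cblock c L n)); first last.
  - move=> j j' x _ _ /hasP[k hk /eqP ->] /hasP[k' hk' /eqP /c_inj E].
    move: hk hk'; rewrite -E !mem_iota => hk hk'.
    by have : (0 < L ^ n)%N by [rewrite expn_gt0 L0]; nia.
  - by move=> j w w' /(wt_depends L0) h; rewrite /F h.
  - exact: iota_uniq.
  by apply: eq_bigr => k _; rewrite exD ex_cst exZ.
rewrite indep.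
have -> : \sum_(k <- s) ex pr S (fun w => z ^+ 5 * F k w) w0 =
    \sum_(k <- s) z ^+ 5 * ex pr S (F k) w0 by apply: eq_bigr => k _; rewrite exZ.
have hLz5 : 0 <= L%:R * z ^+ 5 by rewrite mulr_ge0 ?exprn_ge0 // ltW.
have z5 : 1 <= z ^+ 5 by rewrite exprn_ege1.
have L1 : 1 <= L%:R :> R by rewrite ler1n.
have Lz5 : 1 <= L%:R * z ^+ 5 by nra.
have small : (L%:R * z ^+ 5) ^+ 2 * en <= 1 / 4.
  by apply: le_trans eps_small; rewrite ler_wpM2l ?exprn_ge0.
have br := @prod1D_le (z ^+ 5 * en) [seq z ^+ 5 * ex pr S (F k) w0 | k <- s].
rewrite !big_map size_map size_iota in br.
have {}br := br _ _ _.
have {br}: \prod_(k <- s) (1 + z ^+ 5 * ex pr S (F k) w0) - 1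
   - \sum_(k <- s) z ^+ 5 * ex pr S (F k) w0 <= (L%:R * (z ^+ 5 * en)) ^+ 2.
  apply: br.
  - by rewrite mulr_ge0 // exprn_ge0 // ltW.
  - rewrite mulrA; nra.
  - move=> x /mapP[k _ ->]; rewrite mulr_ge0 ?ex_ge0 ?exprn_ge0 //=; last lra.
    by rewrite ler_wpM2l ?exprn_ge0 ?IH //; lra.
have : z^-1 * \sum_(k <- s) ex pr S (F k) w0 <= en / 4.
  apply: (le_trans (y := z^-1 * \sum_(k <- s) en)).
    apply: ler_wpM2l; first by rewrite invr_ge0 ltW.
    by apply: ler_sum => k _; apply: IH.
  rewrite big_const_seq count_predT size_iota iter_addr_0 -(mulr_natr en L).
  rewrite mulrC ler_pdivrMr //; apply: le_trans (ler_wpM2l en0 Lz) _; lra.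
move=> h1; have -> : (L%:R * (z ^+ 5 * en)) ^+ 2 = ((L%:R * z ^+ 5) ^+ 2 * en) * en by ring.
move=> h2; have h3 : ((L%:R * z ^+ 5) ^+ 2 * en) * en <= 1 / 4 * en by rewrite ler_wpM2r.
have -> : eps / 2 ^+ n.+1 = en / 2 by rewrite /en exprS invfM mulrA mulrAC.
lra.
Qed.

End Moments.

(** * Crossing events *)

Section Crossings.
Local Open Scope nat_scope.
Variables (K : eqType) (ed : bool -> nat -> nat -> K) (L : nat).
Variable v : bool -> nat -> nat -> nat.
Implicit Types (o : bool) (w : K -> bool).

Definition goods o n lo len := [seq i <- iota lo len | v o n i == 0].

(** Stated through pairs, so that its failure is a union over pairs of two simultaneous failures. *)
Definition at_most_one_fails (X : nat -> bool) (s : seq nat) : bool :=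
  all (fun k => all (fun k' => [|| k == k', X k | X k']) s) s.

Definition line n (G : bool -> nat -> nat -> bool)
    (H : bool -> nat -> nat -> nat -> bool) o lo len j : bool :=
  all (fun i => G o i j) (goods o n lo len) &&
  sorted (fun i i' => H o i i' j) (goods o n lo len).

(* site o i j: the level-n block (i, j) is well connected; link o i i' j: the
   blocks (i, j) and (i', j) are joined, i and i' being consecutive good ones.
   Here o is a direction (true = horizontal), i and i' number blocks along o
   and j transversal ones; v o n i is the weight of the i-th block along o, so
   that a block (i, j) is good when v o n i = v (~~ o) n j = 0. *)
Fixpoint site_link n w :
    (bool -> nat -> nat -> bool) * (bool -> nat -> nat -> nat -> bool) :=
  if n is n'.+1 then
    let X := line n' (site_link n' w).1 (site_link n' w).2 in
    let G o i j :=
      at_most_one_fails (X o (i * L) L) (goods (~~ o) n' (j * L) L) &&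
      at_most_one_fails (X (~~ o) (j * L) L) (goods o n' (i * L) L) in
    (G, fun o i i' j =>
      [&& G o i j, G o i' j &
        has (X o (i * L) ((i' - i).+1 * L)) (goods (~~ o) n' (j * L) L)])
  else
    (fun _ _ _ => true,
     fun o i i' j => all (fun a => w (ed o a j)) (iota i (i' - i))).

Definition site n w o i j := (site_link n w).1 o i j.
Definition link n w o i i' j := (site_link n w).2 o i i' j.
Definition cross n w o lo len j :=
  line n (site_link n w).1 (site_link n w).2 o lo len j.

Lemma siteS n w o i j : site n.+1 w o i j =
  at_most_one_fails (cross n w o (i * L) L) (goods (~~ o) n (j * L) L) &&
  at_most_one_fails (cross n w (~~ o) (j * L) L) (goods o n (i * L) L).
Proof. by []. Qed.

Lemma linkS n w o i i' j : link n.+1 w o i i' j =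
  [&& site n.+1 w o i j, site n.+1 w o i' j &
   has (cross n w o (i * L) ((i' - i).+1 * L)) (goods (~~ o) n (j * L) L)].
Proof. by []. Qed.

Lemma crossE n w o lo len j : cross n w o lo len j =
  all (fun i => site n w o i j) (goods o n lo len) &&
  sorted (fun i i' => link n w o i i' j) (goods o n lo len).
Proof. by []. Qed.

Lemma site_sym n w o i j : site n w (~~ o) j i = site n w o i j.
Proof. by case: n => [|n] //; rewrite !siteS negbK andbC. Qed.

Lemma mem_goods o n lo len i : (i \in goods o n lo len) = (v o n i == 0) && (lo <= i < lo + len).
Proof. by rewrite mem_filter mem_iota. Qed.

Lemma goods_uniq o n lo len : uniq (goods o n lo len).
Proof. by rewrite filter_uniq // iota_uniq. Qed.

Lemma goodsD o n lo m1 m2 : goods o n lo (m1 + m2) = goods o n lo m1 ++ goods o n (lo + m1) m2.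
Proof. by rewrite /goods iotaD filter_cat. Qed.

Lemma goods_lt_sorted o n lo len : sorted ltn (goods o n lo len).
Proof. by apply: sorted_filter (iota_ltn_sorted _ _) => x y z; apply: ltn_trans. Qed.

Lemma at_most_one_mono (X Y : nat -> bool) s : (forall k, X k -> Y k) ->
  at_most_one_fails X s -> at_most_one_fails Y s.
Proof.
move=> h; apply: sub_all => k; apply: sub_all => k' /or3P[->//|/h->|/h->];
by rewrite ?orbT.
Qed.

Lemma increasing_site_link n :
  (forall o i j, increasing_event (fun w => site n w o i j)) /\
  (forall o i i' j, increasing_event (fun w => link n w o i i' j)).
Proof.
elim: n => [|n [IHs IHl]].
  by split=> // o i i' j w w' h; apply: sub_all => a; apply: h.
have mX o lo len j w w' : le_cfg w w' -> cross n w o lo len j -> cross n w' o lo len j.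
  move=> h; rewrite !crossE => /andP[h1 h2]; apply/andP; split.
    by apply: sub_all h1 => i; apply: IHs.
  by apply: sub_sorted h2 => i i'; apply: IHl.
have mG o i j : increasing_event (fun w => site n.+1 w o i j).
  move=> w w' h; rewrite !siteS => /andP[h1 h2]; apply/andP.
  by split; [apply: at_most_one_mono h1|apply: at_most_one_mono h2] => k; apply: mX.
split=> // o i i' j w w' h; rewrite !linkS => /and3P[h1 h2 h3].
rewrite (mG _ _ _ _ _ h h1) (mG _ _ _ _ _ h h2) /=.
by apply: sub_has h3 => k; apply: mX.
Qed.

Lemma increasing_cross n o lo len j : increasing_event (fun w => cross n w o lo len j).
Proof.
have [IHs IHl] := increasing_site_link n.
move=> w w' h; rewrite !crossE => /andP[h1 h2]; apply/andP; split.
  by apply: sub_all h1 => i; apply: IHs.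
by apply: sub_sorted h2 => i i'; apply: IHl.
Qed.

End Crossings.

(** * Variables on which the crossing events depend *)

Section Support.
Local Open Scope nat_scope.
Variables (K : eqType) (ed : bool -> nat -> nat -> K) (L : nat).
Variables (is_ed : pred K) (tc : bool -> K -> nat).
Hypothesis is_ed_ed : forall o a b, is_ed (ed o a b).
Hypothesis tc_ed : forall o o' a b, tc o (ed o' a b) = if o == o' then b else a.
Hypothesis L0 : 0 < L.
Implicit Types (o : bool) (w : K -> bool) (v : bool -> nat -> nat -> nat).

(** [tc o] reads the coordinate transversal to [o], so the position along [o] is [tc (~~ o)]. Each
    edge is located by a single point, which makes the rectangles of distinct lines disjoint. *)
Definition rect o a b c d : pred K :=
  fun k => [&& is_ed k, a <= tc (~~ o) k < b & c <= tc o k < d].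

Definition line_rect n o lo len j :=
  rect o (lo * L ^ n) ((lo + len) * L ^ n) (j * L ^ n) (j.+1 * L ^ n).

Lemma rect_sym o a b c d k : rect (~~ o) c d a b k = rect o a b c d k.
Proof. by rewrite /rect negbK; case: (is_ed k) => //=; rewrite andbC. Qed.

Lemma rect_sub o a b c d a' b' c' d' k : a' <= a -> b <= b' -> c' <= c -> d <= d' ->
  rect o a b c d k -> rect o a' b' c' d' k.
Proof. by rewrite /rect => h1 h2 h3 h4 /and3P[-> /andP[h5 h6] /andP[h7 h8]] /=; lia. Qed.

Lemma line_rect_block n o i m j k x : j * L <= k < j * L + L ->
  line_rect n o (i * L) (m * L) k x -> line_rect n.+1 o i m j x.
Proof.
move=> hk; rewrite /line_rect -mulnDl -!mulnA -expnS.
by apply: rect_sub => //; rewrite expnS mulnA leq_mul2r; apply/orP; right; lia.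
Qed.

Lemma line_rect_disjoint n o lo len j j' k :
  line_rect n o lo len j k -> line_rect n o lo len j' k -> j = j'.
Proof.
have Ln0 : 0 < L ^ n by rewrite expn_gt0 L0.
by move=> /and3P[_ _ h1] /and3P[_ _ h2]; nia.
Qed.

Lemma eq_cross v v' n w w' o lo len j :
  goods v o n lo len = goods v' o n lo len ->
  (forall i, lo <= i < lo + len -> site ed L v n w o i j = site ed L v' n w' o i j) ->
  (forall i i', lo <= i < lo + len -> lo <= i' < lo + len -> i < i' ->
     link ed L v n w o i i' j = link ed L v' n w' o i i' j) ->
  cross ed L v n w o lo len j = cross ed L v' n w' o lo len j.
Proof.
move=> gE h1 h2; rewrite !crossE -gE.
have gP i : i \in goods v o n lo len -> lo <= i < lo + len.
  by rewrite mem_goods => /andP[].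
congr (_ && _); first by apply: eq_in_all => i /gP; apply: h1.
have := goods_lt_sorted v o n lo len; case: (goods _ _ _ _) gP {gE h1} => //= i s.
elim: s i => //= i' s IH i gP /andP[ii' hs].
rewrite (h2 i i') ?gP ?inE ?eqxx ?orbT //; congr andb; apply: IH => // a ha.
by apply: gP; rewrite inE ha orbT.
Qed.

(** The environment is random too: a crossing inside the box of side [N] must be determined by
    finitely many removal variables as well as edge variables. *)
Definition same_env N v v' := forall o n i, i.+1 * L ^ n <= N -> v o n i = v' o n i.

Lemma eq_goods N v v' o n lo len : same_env N v v' -> (lo + len) * L ^ n <= N ->
  goods v o n lo len = goods v' o n lo len.
Proof.
move=> hv hN; apply: eq_in_filter => i; rewrite mem_iota => hi; rewrite hv //.
by apply: leq_trans hN; rewrite leq_mul2r; apply/orP; right; lia.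
Qed.

Lemma site_link_ext N v v' w w' : same_env N v v' -> forall n,
  (forall o i j, i.+1 * L ^ n <= N -> j.+1 * L ^ n <= N ->
     (forall x, line_rect n o i 1 j x -> w x = w' x) ->
     site ed L v n w o i j = site ed L v' n w' o i j) /\
  (forall o i i' j, i <= i' -> i'.+1 * L ^ n <= N -> j.+1 * L ^ n <= N ->
     (forall x, line_rect n o i (i' - i).+1 j x -> w x = w' x) ->
     link ed L v n w o i i' j = link ed L v' n w' o i i' j).
Proof.
move=> hv; elim=> [|n [IHs IHl]].
  split=> // o i i' j ii' _ _ h; rewrite /link /=; apply: eq_in_all => a.
  rewrite mem_iota => ha; apply: h.
  rewrite /line_rect /rect is_ed_ed !tc_ed eqxx; case: o => /=; rewrite !expn0 !muln1; lia.
have Ln0 : 0 < L ^ n by rewrite expn_gt0 L0.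
have dX o lo len j : (lo + len) * L ^ n <= N -> j.+1 * L ^ n <= N ->
    (forall x, line_rect n o lo len j x -> w x = w' x) ->
    cross ed L v n w o lo len j = cross ed L v' n w' o lo len j.
  move=> hN hj h; apply: eq_cross => [|i hi|i i' hi hi' ii'].
  - exact: eq_goods hv hN.
  - apply: IHs => //; first by nia.
    by move=> k hk; apply: h; apply: rect_sub hk => //; nia.
  - apply: IHl => //; [exact: ltnW|by nia|].
    by move=> k hk; apply: h; apply: rect_sub hk => //; nia.
have sub i k : i.+1 * L ^ n.+1 <= N -> i * L <= k < i * L + L -> k.+1 * L ^ n <= N.
  by move=> hi hk; apply: leq_trans hi; rewrite expnS mulnA leq_mul2r; apply/orP; right; lia.
have len_le i m : (i + m) * L ^ n.+1 <= N -> (i * L + m * L) * L ^ n <= N.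
  by rewrite -mulnDl -mulnA -expnS.
have dX1 o i j k : i.+1 * L ^ n.+1 <= N -> j.+1 * L ^ n.+1 <= N ->
    (forall x, line_rect n.+1 o i 1 j x -> w x = w' x) ->
    k \in goods v (~~ o) n (j * L) L ->
    cross ed L v n w o (i * L) L k = cross ed L v' n w' o (i * L) L k.
  move=> hi hj h; rewrite mem_goods => /andP[_ hk]; apply: dX.
  - by have := len_le i 1; rewrite mul1n addn1; apply.
  - exact: sub hj hk.
  by move=> x hx; apply: h; apply: (line_rect_block hk); rewrite mul1n.
have amo (X Y : nat -> bool) s : {in s, X =1 Y} ->
    at_most_one_fails X s = at_most_one_fails Y s.
  move=> h; apply: eq_in_all => k hk; apply: eq_in_all => k' hk'.
  by rewrite (h k) ?(h k').
have gE o i : i.+1 * L ^ n.+1 <= N -> goods v o n (i * L) L = goods v' o n (i * L) L.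
  by move=> hi; apply: (eq_goods _ hv); have := len_le i 1; rewrite mul1n addn1; apply.
have dG o i j : i.+1 * L ^ n.+1 <= N -> j.+1 * L ^ n.+1 <= N ->
    (forall x, line_rect n.+1 o i 1 j x -> w x = w' x) ->
    site ed L v n.+1 w o i j = site ed L v' n.+1 w' o i j.
  move=> hi hj h; rewrite !siteS -!gE //; congr andb; apply: amo => k hk; first exact: dX1 hk.
  apply: (@dX1 (~~ o) j i k) => // [x hx|]; last by rewrite negbK.
  by apply: h; move: hx; rewrite /line_rect rect_sym !addn1.
split=> // o i i' j ii' hi' hj h; rewrite !linkS -gE //; congr [&& _, _ & _].
- apply: dG => //; first by apply: leq_trans hi'; rewrite leq_mul2r ltnS ii' orbT.
  by move=> x hx; apply: h; move: hx; apply: rect_sub => //; nia.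
- by apply: dG => // x hx; apply: h; move: hx; apply: rect_sub => //; nia.
apply: eq_in_has => k; rewrite mem_goods => /andP[_ hk].
apply: dX; [|exact: sub hj hk|by move=> x /(line_rect_block hk) hx; apply: h].
by apply: len_le; rewrite addnS subnKC.
Qed.

Lemma cross_ext N v v' w w' n o lo len j : same_env N v v' ->
  (lo + len) * L ^ n <= N -> j.+1 * L ^ n <= N ->
  (forall x, line_rect n o lo len j x -> w x = w' x) ->
  cross ed L v n w o lo len j = cross ed L v' n w' o lo len j.
Proof.
move=> hv hN hj h; have [IHs IHl] := site_link_ext w w' hv n.
have Ln0 : 0 < L ^ n by rewrite expn_gt0 L0.
apply: eq_cross => [|i hi|i i' hi hi' ii'].
- exact: eq_goods hv hN.
- apply: IHs => //; first by nia.
  by move=> k hk; apply: h; apply: rect_sub hk => //; nia.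
- apply: IHl => //; [exact: ltnW|by nia|].
  by move=> k hk; apply: h; apply: rect_sub hk => //; nia.
Qed.

Lemma depends_cross v n o lo len j :
  depends_on (line_rect n o lo len j) (fun w => cross ed L v n w o lo len j).
Proof.
move=> w w'; apply: (@cross_ext ((lo + len + j.+1) * L ^ n)) => //.
  by rewrite leq_mul2r leq_addr orbT.
by rewrite leq_mul2r leq_addl orbT.
Qed.

End Support.

(** * Probability of crossing events *)

Section RealInequalities.
Variable R : realFieldType.

(** Each failure has probability at most [T / (1 + T)], so with [m] attempts Bernoulli's inequality
    bounds the joint failure by [T / (T + m)]; success then has probability at least
    [1 / (1 + T / m)]. *)
Lemma bernoulli_prod (s : seq R) (T B : R) : 0 < T -> (0 < size s)%N ->
  (forall P, P \in s -> 0 <= P <= 1 /\ 1 <= P * (1 + T)) ->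
  T <= B * (size s)%:R ->
  1 <= (1 - \prod_(P <- s) (1 - P)) * (1 + B).
Proof.
move=> T0 s0 hs hB.
have : 0 <= \prod_(P <- s) (1 - P) <= 1 /\
       \prod_(P <- s) (1 - P) * (T + (size s)%:R) <= T.
  elim: s hs {s0 hB} => [|P s IH] hs /=; first by rewrite big_nil mulr0n addr0 mul1r !lexx ler01.
  have [/andP[P0 P1] PT] := hs P (mem_head _ _).
  have [] := IH (fun Q hQ => hs Q (@mem_behead _ (P :: s) Q hQ)).
  rewrite big_cons -natr1; set f := \prod_(P <- s) _; set m : R := (size s)%:R.
  move=> /andP[f0 f1] hf; have m0 : 0 <= m by rewrite ler0n.
  split; first by apply/andP; split; nra.
  have u0 : 0 <= 1 - P by lra.
  have uT : (1 - P) * (1 + T) <= T by lra.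
  have : (f * (T + m)) * ((1 - P) * (1 + T)) <= T * T.
    by apply: ler_pM => //; rewrite mulr_ge0 //; lra.
  have fu0 : 0 <= f * (1 - P) by rewrite mulr_ge0.
  have : f * (1 - P) * m >= 0 by rewrite mulr_ge0.
  set x := f * (1 - P) in fu0 *; move=> xm h.
  have {}h : x * ((T + m) * (1 + T)) <= T * T by move: h; rewrite /x; lra.
  rewrite -(ler_pM2r T0) (_ : (1 - P) * f = x); last by rewrite /x mulrC.
  apply: le_trans h; rewrite -mulrA ler_wpM2l //; lra.
set f := \prod_(P <- s) _; set m : R := (size s)%:R in hB *.
have m0 : 0 < m by rewrite ltr0n.
move=> [/andP[f0 f1] hf].
have : (f * (1 + B)) * m <= B * m.
  have : (1 - f) * T <= (1 - f) * (B * m) by rewrite ler_wpM2l //; lra.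
  lra.
rewrite ler_pM2r //; lra.
Qed.

Lemma prod_le_sqr (s : seq R) (t : R) : t <= 1 -> (1 < size s)%N ->
  (forall P, P \in s -> 0 <= 1 - P <= t) ->
  \prod_(P <- s) (1 - P) <= t ^+ 2.
Proof.
move=> t1; case: s => [|P [|Q s]] //= _ hs.
have /andP[P0 Pt] := hs P (mem_head _ _).
have /andP[Q0 Qt] : 0 <= 1 - Q <= t by apply: hs; rewrite !inE eqxx orbT.
rewrite !big_cons mulrA expr2 -[leRHS]mulr1; apply: ler_pM.
- exact: mulr_ge0.
- rewrite big_seq prodr_ge0 // => X hX.
  by have /andP[] : 0 <= 1 - X <= t by apply: hs; rewrite !inE hX !orbT.
- exact: ler_pM.
rewrite big_seq; apply: (le_trans (y := \prod_(X <- s | X \in s) 1)); last by rewrite big1.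
apply: ler_prod => X hX.
have /andP[h0 h1] : 0 <= 1 - X <= t by apply: hs; rewrite !inE hX !orbT.
by rewrite h0 (le_trans h1).
Qed.

(** Lower bounds [P >= 1 / c] are kept in the form [1 <= P * c], in which they multiply without
    divisions. *)
Lemma mul_lower (x y z a b c : R) : 0 <= a -> 0 <= b -> 0 <= x -> 0 <= y ->
  1 <= x * a -> 1 <= y * b -> x * y <= z -> a * b <= c -> 1 <= z * c.
Proof.
move=> a0 b0 x0 y0 h1 h2 hz hc.
apply: (le_trans (y := (x * y) * (a * b))).
  by rewrite mulrACA -[1]mulr1; apply: ler_pM.
by apply: ler_pM => //; rewrite mulr_ge0.
Qed.

Lemma exp1D_le (x : R) m : 0 <= x -> (1 + x) ^+ m * (1 - m%:R * x) <= 1.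
Proof.
move=> x0; elim: m => [|m IH]; first by rewrite expr0 mul0r subr0 mulr1.
apply: le_trans IH; rewrite exprS mulrAC mulrC ler_wpM2l ?exprn_ge0 ?addr_ge0 //.
rewrite -natr1; have : 0 <= m%:R :> R by rewrite ler0n.
set k : R := m%:R => k0; have : 0 <= k * x by rewrite mulr_ge0.
nra.
Qed.
End RealInequalities.

(** * Induction over the levels *)

Section Bounds.
Variables (R : realFieldType) (K : eqType) (pr : K -> R).
Variables (ed : bool -> nat -> nat -> K) (L : nat) (v : bool -> nat -> nat -> nat).
Variables (is_ed : pred K) (tc : bool -> K -> nat) (A0 : R).
Hypothesis pr01 : forall k, 0 <= pr k <= 1.
Hypothesis is_ed_ed : forall o a b, is_ed (ed o a b).
Hypothesis tc_ed : forall o o' a b, tc o (ed o' a b) = if o == o' then b else a.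
Hypothesis Lbig : 10 ^+ 6 <= L%:R :> R.
Hypothesis A0_gt0 : 0 < A0.
Hypothesis A0_small : A0 * L%:R ^+ 5 <= 1.
Hypothesis pr_ed : forall o a b, 1 <= pr (ed o a b) * (1 + A0 / (4 * L%:R)).
Hypothesis vS : forall o n i, v o n.+1 i = merge (map (v o n) (iota (i * L) L)).

Definition amp n : R := A0 / 16 ^+ n.
(** The divisor is such that [2 * L] factors [1 + defect n] cost at most one unit of the exponent of
    [resist], see [defect_exp]. *)
Definition defect n : R := amp n / (4 * L%:R).
(* The term - 1 makes resist supermultiplicative in the exponent and equal to 1
   on empty runs. *)
Definition resist n (E : nat) : R := 1 + amp n * (2 ^+ E - 1).

Local Notation lr := (L%:R : R).

Let L_gt0 : 0 < lr. Proof. by apply: lt_le_trans Lbig; rewrite exprn_gt0. Qed.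
Let L_gt1 : (1 < L)%N.
Proof. by rewrite -(ltr_nat R); apply: lt_le_trans Lbig; rewrite exprn_egt1 // ltr1n. Qed.
Let L_gt0n : (0 < L)%N. Proof. exact: ltnW. Qed.

Lemma amp_gt0 n : 0 < amp n. Proof. by rewrite divr_gt0 // exprn_gt0. Qed.
Lemma defect_gt0 n : 0 < defect n. Proof. by rewrite divr_gt0 ?amp_gt0 // mulr_gt0. Qed.
Lemma ampS n : amp n.+1 = amp n / 16.
Proof. by rewrite /amp exprS invfM mulrA mulrAC. Qed.

Lemma amp_small n : amp n * lr ^+ 5 <= 1.
Proof.
elim: n => [|n IH]; first by rewrite /amp expr0 divr1.
rewrite ampS; apply: le_trans IH; rewrite ler_wpM2r ?exprn_ge0 ?ltW //.
by have := amp_gt0 n; lra.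
Qed.

Lemma amp_tiny n : amp n * lr ^+ 4 <= 1 / 10 ^+ 6.
Proof.
rewrite ler_pdivlMr ?exprn_gt0 //; apply: le_trans (amp_small n).
rewrite (exprSr _ 4) mulrA ler_wpM2l // mulr_ge0 ?exprn_ge0 ?ltW //; exact: amp_gt0.
Qed.

Lemma amp_le1 n : amp n <= 1.
Proof.
apply: le_trans (amp_small n); apply: ler_peMr; first exact: ltW (amp_gt0 n).
by rewrite exprn_ege1 // ler1n.
Qed.

Lemma resist_ge1 n E : 1 <= resist n E.
Proof.
rewrite /resist lerDl mulr_ge0 ?subr_ge0 ?exprn_ege1 ?ler1n //; exact/ltW/amp_gt0.
Qed.

Lemma resist_mono n E E' : (E <= E')%N -> resist n E <= resist n E'.
Proof.
move=> h; rewrite /resist lerD2l; apply: ler_wpM2l; first exact: ltW (amp_gt0 n).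
rewrite lerD2r.
by rewrite ler_weXn2l // ler1n.
Qed.

Lemma resist_mul n E E' : resist n E * resist n E' <= resist n (E + E').
Proof.
rewrite /resist exprD; have := amp_gt0 n; have := amp_le1 n.
have : 1 <= 2 ^+ E :> R by rewrite exprn_ege1 ?ler1n.
have : 1 <= 2 ^+ E' :> R by rewrite exprn_ege1 ?ler1n.
move: (amp n) (2 ^+ E : R) (2 ^+ E' : R) => a x y hy hx a1 a0.
have : 0 <= a * (1 - a) * ((x - 1) * (y - 1)).
  by do !apply: mulr_ge0; rewrite ?subr_ge0 //; exact: ltW.
lra.
Qed.

Lemma resist_exp n E : resist n 1 ^+ E <= resist n E.
Proof.
elim: E => [|E IH]; first by rewrite expr0 resist_ge1.
rewrite exprS; apply: le_trans (resist_mul n 1 E); rewrite ler_wpM2l //.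
by apply: le_trans (resist_ge1 n 1).
Qed.

(** With [a = amp n <= 1], [exp1D_le] bounds the power by [1 / (1 - a / 2)], and
    [(1 - a / 2) (1 + a) >= 1]. *)
Lemma defect_exp n : (1 + defect n) ^+ (2 * L) <= resist n 1.
Proof.
have := exp1D_le (2 * L) (ltW (defect_gt0 n)).
have -> : (2 * L)%:R * defect n = amp n / 2.
  by rewrite natrM /defect; field; rewrite gt_eqF.
rewrite /resist expr1; have := amp_gt0 n; have := amp_le1 n.
have : 0 <= (1 + defect n) ^+ (2 * L) by rewrite exprn_ge0 // addr_ge0 // ltW // defect_gt0.
set y := _ ^+ _; set a := amp n => y0 a1 a0 h.
have : y * ((1 - a / 2) * (1 + a)) <= 1 + a.
  by rewrite mulrA -[leRHS]mul1r ler_wpM2r //; lra.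
move=> h2; rewrite (_ : a * (2 - 1) = a); last by ring.
apply: le_trans h2; rewrite -[leLHS]mulr1 ler_wpM2l //; nra.
Qed.

Lemma defect_le1 n : defect n <= 1.
Proof.
rewrite /defect ler_pdivrMr ?mulr_gt0 // mul1r.
have := amp_le1 n; have : 1 <= lr by rewrite ler1n.
lra.
Qed.

Definition reduced_cost o n i r := cost false (map (v o n) (iota i.+1 r)).
Definition all_bad o n i r := all (fun w => (0 < w)%N) (map (v o n) (iota i.+1 r)).

Variables (S : seq K) (w0 : K -> bool).
Hypothesis w0_ed : forall o a b, w0 (ed o a b).

Local Notation site := (site ed L v).
Local Notation link := (link ed L v).
Local Notation cross := (cross ed L v).
Local Notation goods := (goods v).
Local Notation PrS e := (Pr pr S e w0).

(** The fraction 1/8 lets one factor [1 + defect n] absorb up to three factors [1 - defect n / 8],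
    as [link_step] requires. *)
Definition site_bound n := forall o i j, v o n i = 0%N -> v (~~ o) n j = 0%N ->
  1 - defect n / 8 <= PrS (fun w => site n w o i j).

Definition link_bound n := forall o i r j, v o n i = 0%N -> v o n (i + r).+1 = 0%N ->
  v (~~ o) n j = 0%N -> all_bad o n i r ->
  1 <= PrS (fun w => link n w o i (i + r).+1 j) *
       ((1 + defect n) * resist n (reduced_cost o n i r)).

Lemma Pr_and_lower e1 e2 (a b c : R) : increasing_event e1 -> increasing_event e2 ->
  0 <= a -> 0 <= b -> 1 <= PrS e1 * a -> 1 <= PrS e2 * b -> a * b <= c ->
  1 <= PrS (fun w => e1 w && e2 w) * c.
Proof.
move=> m1 m2 a0 b0 h1 h2 hc.
apply: (mul_lower a0 b0 _ _ h1 h2 _ hc); rewrite ?Pr_ge0 //.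
exact: Pr_and_ge.
Qed.

(** Union bound over ordered pairs of distinct indices, whose failures are independent because the
    supports are disjoint. *)
Lemma Pr_pair_fail (X : nat -> (K -> bool) -> bool) (A : nat -> pred K) (s : seq nat) (t : R) :
  uniq s -> (forall k, depends_on (A k) (X k)) ->
  (forall k k' x, A k x -> A k' x -> k = k') ->
  (forall k, k \in s -> 1 - PrS (X k) <= t) ->
  PrS (fun w => ~~ at_most_one_fails (X ^~ w) s) <= ((size s)%:R * t) ^+ 2.
Proof.
move=> us dX dA ht.
pose F k w : R := 1 - (X k w)%:R.
have F0 k w : 0 <= F k w by rewrite /F; case: (X k w); rewrite ?subrr ?subr0.
apply: (le_trans (y := ex pr S (fun w => \sum_(k <- s) \sum_(k' <- s | k' != k) F k w * F k' w) w0)).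
  apply: ex_le => // w.
  have S0 k : 0 <= \sum_(k' <- s | k' != k) F k w * F k' w.
    by rewrite sumr_ge0 // => k' _; rewrite mulr_ge0.
  case: (boolP (at_most_one_fails _ _)) => [_|]; first by rewrite sumr_ge0.
  case/allPn => k hk /allPn [k' hk']; rewrite !negb_or => /and3P[kk' nk nk'].
  rewrite (big_rem k) //= -[leLHS]addr0 lerD //; last by rewrite sumr_ge0.
  rewrite (big_rem k') //= eq_sym kk' -[leLHS]addr0 lerD //.
    by rewrite /F (negbTE nk) (negbTE nk') !subr0 mulr1.
  by rewrite sumr_ge0 // => k'' _; rewrite mulr_ge0.
have dF k : depends_on (A k) (F k) by move=> w w' h; rewrite /F (dX k w w').
have Ft k : k \in s -> 0 <= ex pr S (F k) w0 <= t.
  move=> hk; rewrite ex_ge0 //=; apply: le_trans (ht k hk).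
  by rewrite /F exD // exN // ex_cst.
have st : \sum_(k <- s) t = (size s)%:R * t.
  by rewrite big_const_seq count_predT iter_addr_0 mulr_natl.
rewrite ex_sum // expr2 -{1}st big_distrl /= [leLHS]big_seq [leRHS]big_seq.
apply: ler_sum => k hk; rewrite ex_sum // -st big_distrr /= big_mkcond /=.
rewrite [leLHS]big_seq [leRHS]big_seq; apply: ler_sum => k' hk'.
have /andP[a0 at_] := Ft k hk; have /andP[b0 bt] := Ft k' hk'.
case: ifP => kk'; last by rewrite mulr_ge0 // (le_trans a0).
rewrite (@ex_mul_indep _ _ pr S _ _ _ w0 (dF k)) ?ler_pM // => w w' h.
by apply: (dF k') => x hx; apply: h; apply: contraNN kk' => hx'; apply/eqP; exact: dA hx hx'.
Qed.

Lemma Pr_has_indep (X : nat -> (K -> bool) -> bool) (A : nat -> pred K) (s : seq nat) :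
  uniq s -> (forall k, depends_on (A k) (X k)) ->
  (forall k k' x, A k x -> A k' x -> k = k') ->
  PrS (fun w => has (X ^~ w) s) = 1 - \prod_(k <- s) (1 - PrS (X k)).
Proof.
move=> us dX dA.
pose F k w : R := 1 - (X k w)%:R.
have dF k : depends_on (A k) (F k) by move=> w w' h; rewrite /F (dX k w w').
have -> : \prod_(k <- s) (1 - PrS (X k)) = ex pr S (fun w => \prod_(k <- s) F k w) w0.
  rewrite (ex_prod_indep pr01 _ _ us dF) => [|k k' x _ _]; last exact: dA.
  by apply: eq_bigr => k _; rewrite /F exD // exN // ex_cst.
transitivity (ex pr S (fun w => 1 + - \prod_(k <- s) F k w) w0); last first.
  by rewrite exD exN ex_cst.
apply: ex_ext => // w.
elim: s {us} => [|k s IH] /=; first by rewrite big_nil subrr.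
rewrite big_cons /F; case: (X k w) => /=; first by rewrite subrr mul0r subr0.
by rewrite subr0 mul1r IH.
Qed.

Section CrossBound.
Variable n : nat.
Hypothesis hs : site_bound n.
Hypothesis hl : link_bound n.

Let th0 : 0 <= 1 + defect n.
Proof. by rewrite addr_ge0 // ltW // defect_gt0. Qed.
Let res0 E : 0 <= resist n E.
Proof. exact: le_trans (resist_ge1 n E). Qed.

Lemma sites_bound o lo len j : v (~~ o) n j = 0%N ->
  1 <= PrS (fun w => all (fun i => site n w o i j) (goods o n lo len)) *
       (1 + defect n) ^+ len.
Proof.
move=> vj; have [ms _] := increasing_site_link ed L v n.
elim: len lo => [|len IH] lo; first by rewrite (Pr_sure pr01) // mul1r.
rewrite /goods /=; case: ifP => /eqP vi; last first.
  apply: le_trans (IH lo.+1) _; rewrite exprS ler_wpM2l ?Pr_ge0 //.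
  by rewrite ler_peMl ?exprn_ge0 // lerDl ltW // defect_gt0.
apply: (@Pr_and_lower _ _ (1 + defect n) ((1 + defect n) ^+ len)).
- exact: ms.
- by move=> w w' h; apply: sub_all => i; apply: ms.
- exact: th0.
- exact: exprn_ge0.
- have := hs vi vj; have := defect_le1 n; have := defect_gt0 n; nra.
- exact: IH.
- by rewrite exprS.
Qed.

(** The line is scanned from left to right: [i] is the last good block met, [r] counts the bad
    blocks since, and [len] blocks remain. Each new good block closes a link and restarts the
    count. *)
Lemma path_bound o j len r i : v (~~ o) n j = 0%N -> v o n i = 0%N -> all_bad o n i r ->
  1 <= PrS (fun w => path (fun i i' => link n w o i i' j) i (goods o n (i + r).+1 len)) *
       ((1 + defect n) ^+ len * resist n (reduced_cost o n i (r + len))).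
Proof.
move=> vj; have [_ ml] := increasing_site_link ed L v n.
elim: len r i => [|len IH] r i vi bad.
  by rewrite (Pr_sure pr01) // !mul1r resist_ge1.
rewrite /goods /=; case: ifP => /eqP va; last first.
  have /(IH _ _ vi) : all_bad o n i r.+1.
    by rewrite /all_bad -(addn1 r) iotaD map_cat all_cat -/(all_bad _ _ _ _) bad /= addSn lt0n andbT; apply/eqP.
  rewrite addnS addSnnS => /le_trans; apply; rewrite ler_wpM2l ?Pr_ge0 //.
  by rewrite ler_wpM2r // exprS ler_peMl ?exprn_ge0 // lerDl ltW // defect_gt0.
apply: (@Pr_and_lower _ _ ((1 + defect n) * resist n (reduced_cost o n i r))
   ((1 + defect n) ^+ len * resist n (reduced_cost o n (i + r).+1 len))).
- exact: ml.
- by move=> w w' h; apply: sub_path => a b; apply: ml.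
- exact: mulr_ge0.
- by rewrite mulr_ge0 // exprn_ge0.
- exact: hl.
- have := IH 0%N (i + r).+1 va isT; by rewrite addn0.
rewrite mulrACA -exprS ler_wpM2l ?exprn_ge0 //.
have -> : reduced_cost o n i (r + len.+1) =
   (reduced_cost o n i r + reduced_cost o n (i + r).+1 len)%N.
  by rewrite /reduced_cost iotaD map_cat cost_cat /= !addSn va.
exact: resist_mul.
Qed.

Lemma cost_false_le b ws : (cost false ws <= cost b ws)%N.
Proof. by case: ws => [|[|w] ws] //=; rewrite leq_add2r leq_add2l. Qed.

(** Bad blocks before the first good one need no link, and dropping them does not increase the cost;
    [path_bound] handles the rest. *)
Lemma sorted_bound o j len lo : v (~~ o) n j = 0%N ->
  1 <= PrS (fun w => sorted (fun i i' => link n w o i i' j) (goods o n lo len)) *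
       ((1 + defect n) ^+ len * resist n (cost false (map (v o n) (iota lo len)))).
Proof.
move=> vj; elim: len lo => [|len IH] lo.
  by rewrite (Pr_sure pr01) // !mul1r resist_ge1.
rewrite /goods /=; case: ifP => /eqP va; last first.
  apply: le_trans (IH lo.+1) _; rewrite ler_wpM2l ?Pr_ge0 // ler_pM ?exprn_ge0 //.
    by rewrite exprS ler_peMl ?exprn_ge0 // lerDl ltW // defect_gt0.
  apply: resist_mono; case: (v o n lo) va => // w _.
  by apply: leq_trans (leq_addl _ _); apply: cost_false_le.
have := @path_bound o j len 0 lo vj va isT; rewrite addn0 add0n => /le_trans; apply.
rewrite va ler_wpM2l ?Pr_ge0 // ler_wpM2r // exprS ler_peMl ?exprn_ge0 //.
by rewrite lerDl ltW // defect_gt0.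
Qed.

(** Harris' inequality combines sites and links. Each gives [m * L] factors [1 + defect n], together
    at most [m] units of the exponent by [defect_exp]. *)
Lemma cross_bound o m j lo : v (~~ o) n j = 0%N ->
  1 <= PrS (fun w => cross n w o lo (m * L) j) *
       resist n (cost false (map (v o n) (iota lo (m * L))) + m).
Proof.
move=> vj; have [ms ml] := increasing_site_link ed L v n.
apply: (Pr_and_lower _ _ _ _ (sites_bound lo (m * L) vj) (sorted_bound (m * L) lo vj)).
- by move=> w w' h; apply: sub_all => i; apply: ms.
- by move=> w w' h; apply: sub_sorted => a b; apply: ml.
- exact: exprn_ge0.
- by rewrite mulr_ge0 // exprn_ge0.
rewrite mulrA -exprD addnn -mul2n mulnCA mulnC exprM mulrC addnC.
apply: le_trans (resist_mul _ _ _); rewrite mulrC ler_wpM2r //.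
apply: le_trans (resist_exp n m); rewrite lerXn2r ?nnegrE ?exprn_ge0 //.
exact: defect_exp.
Qed.

(** A good block has cost at most 4 and [cross_bound] adds 1, so 31 is [2 ^+ 5 - 1]. *)
Lemma cross_block_fail o i j : v o n.+1 i = 0%N -> v (~~ o) n j = 0%N ->
  1 - PrS (fun w => cross n w o (i * L) L j) <= 31 * amp n.
Proof.
move=> vi vj; have := @cross_bound o 1 j (i * L) vj; rewrite mul1n.
have hc := cost_good_block L_gt1 (vS o n) vi.
move=> h; have {h} : 1 <= PrS (fun w => cross n w o (i * L) L j) * resist n 5.
  apply: le_trans h _; rewrite ler_wpM2l ?Pr_ge0 //; apply: resist_mono.
  by rewrite addn1 ltnS.
have := Pr_le1 pr01 S (fun w => cross n w o (i * L) L j) w0.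
have := Pr_ge0 pr01 S (fun w => cross n w o (i * L) L j) w0.
set P := PrS _; rewrite /resist.
have -> : 2 ^+ 5 - 1 = 31 :> R by ring.
have := amp_gt0 n; nra.
Qed.


Lemma size_goods o lo len : (size (goods o n lo len) <= len)%N.
Proof. by rewrite size_filter -[leqRHS](size_iota lo len) count_size. Qed.

Lemma cross_pair_fail o i j : v o n.+1 i = 0%N -> v (~~ o) n.+1 j = 0%N ->
  PrS (fun w => ~~ at_most_one_fails (cross n w o (i * L) L) (goods (~~ o) n (j * L) L))
  <= (lr * (31 * amp n)) ^+ 2.
Proof.
move=> vi vj; apply: le_trans (@Pr_pair_fail (fun k w => cross n w o (i * L) L k)
  (line_rect L is_ed tc n o (i * L) L) _ (31 * amp n) _ _ _ _) _.
- exact: goods_uniq.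
- by move=> k; exact: (depends_cross is_ed_ed tc_ed L_gt0n).
- by move=> k k' x; apply: line_rect_disjoint.
- move=> k; rewrite mem_goods => /andP[/eqP vk _]; exact: cross_block_fail.
have a0 : 0 <= 31 * amp n by rewrite mulr_ge0 // ltW // amp_gt0.
move: (31 * amp n) a0 => t t0.
apply: lerXn2r; rewrite ?nnegrE ?mulr_ge0 ?ler0n //.
by rewrite ler_wpM2r // ler_nat size_goods.
Qed.

Lemma site_step : site_bound n.+1.
Proof.
move=> o i j vi vj.
rewrite lerBlDr -lerBlDl -(PrC pr01).
apply: (le_trans (y :=
  PrS (fun w => ~~ at_most_one_fails (cross n w o (i * L) L) (goods (~~ o) n (j * L) L)) +
  PrS (fun w => ~~ at_most_one_fails (cross n w (~~ o) (j * L) L) (goods o n (i * L) L)))).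
  rewrite /Pr -exD //; apply: ex_le => // w; rewrite siteS.
  by case: at_most_one_fails; case: at_most_one_fails; rewrite ?addr0 ?add0r ?lerDl.
have h1 := cross_pair_fail vi vj.
have h2 : PrS (fun w => ~~ at_most_one_fails (cross n w (~~ o) (j * L) L) (goods o n (i * L) L))
    <= (lr * (31 * amp n)) ^+ 2.
  by have := @cross_pair_fail (~~ o) j i; rewrite negbK; apply.
apply: le_trans (lerD h1 h2) _.
rewrite /defect ampS 3?ler_pdivlMr ?mulr_gt0 //.
have := amp_tiny n; have := amp_gt0 n; set a := amp n => a0 ha.
have L3 : lr ^+ 3 <= lr ^+ 4 by rewrite ler_eXn2l // (lt_le_trans _ Lbig) // exprn_egt1 // ltr1n.
have {}L3 : a * lr ^+ 3 <= a * lr ^+ 4 by rewrite ler_wpM2l // ltW.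
(* Two directions, each failing with probability at most [(31 L a)^2], against
   [defect n.+1 / 8 = a / (512 L)]. *)
have {}L3 : a * lr ^+ 3 * (31 * 31 * 1024) <= 1 by lra.
by have := ler_wpM2l (ltW a0) L3; lra.
Qed.

(** Harris' inequality combines the two end sites with the existence of a crossed line among at
    least [L - 1] independent ones. *)
Lemma link_step : site_bound n.+1 -> link_bound n.+1.
Proof.
move=> hs' o i r j vi vi' vj bad.
have [ms _] := increasing_site_link ed L v n.+1.
have sb i1 : v o n.+1 i1 = 0%N -> 1 - defect n.+1 / 8 <= PrS (fun w => site n.+1 w o i1 j).
  by move=> h; apply: hs'.
pose X k w := cross n w o (i * L) (r.+2 * L) k.
pose s := goods (~~ o) n (j * L) L.
have hcost := cost_range L_gt1 (vS o n) vi vi' bad.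
have mX k : increasing_event (X k) by exact: increasing_cross.
(* The 14 is the 12 of [cost_range] plus 2: its gain [r] pays for all but 2 of the [r + 2] units
   added by [cross_bound]. *)
have XP k : k \in s -> 0 <= PrS (X k) <= 1 /\
   1 <= PrS (X k) * (1 + amp n * (2 ^+ (reduced_cost o n.+1 i r + 14) - 1)).
  rewrite mem_goods => /andP[/eqP vk _]; rewrite Pr_ge0 // Pr_le1 //; split => //.
  have := @cross_bound o r.+2 k (i * L) vk => /le_trans; apply.
  rewrite ler_wpM2l ?Pr_ge0 //; apply: resist_mono.
  by rewrite /reduced_cost; lia.
have sz : (L.-1 <= size s)%N by exact: (count_good_block L_gt1 (vS (~~ o) n) vj).
have L1r : lr = L.-1%:R + 1 by rewrite natr1 prednK.
have szr : lr - 1 <= (size s)%:R by rewrite L1r addrK ler_nat.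
have Pall : PrS (fun w => has (X ^~ w) s) = 1 - \prod_(k <- s) (1 - PrS (X k)).
  apply: (Pr_has_indep (A := line_rect L is_ed tc n o (i * L) (r.+2 * L))).
  - exact: goods_uniq.
  - by move=> k; exact: (depends_cross is_ed_ed tc_ed L_gt0n).
  - by move=> k k' x; apply: line_rect_disjoint.
have target : 1 <= (1 - defect n.+1 / 8) ^+ 2 * (PrS (fun w => has (X ^~ w) s) *
          ((1 + defect n.+1) * resist n.+1 (reduced_cost o n.+1 i r))) ->
    1 <= PrS (fun w => link n.+1 w o i (i + r).+1 j) *
      ((1 + defect n.+1) * resist n.+1 (reduced_cost o n.+1 i r)).
  move=> /le_trans; apply; rewrite [leLHS]mulrA; apply: ler_wpM2r.
    apply: mulr_ge0; last exact: le_trans ler01 (resist_ge1 _ _).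
    exact: addr_ge0 ler01 (ltW (defect_gt0 _)).
  have d1 : 0 <= 1 - defect n.+1 / 8 by have := defect_le1 n.+1; lra.
  have step1 : (1 - defect n.+1 / 8) * PrS (fun w => has (X ^~ w) s) <=
      PrS (fun w => site n.+1 w o (i + r).+1 j && has (X ^~ w) s).
    apply: le_trans (Pr_and_ge pr01 _ _ (ms _ _ _) _); last first.
      by move=> w w' h; apply: sub_has => k; apply: mX.
    by rewrite ler_wpM2r ?Pr_ge0 // sb.
  rewrite expr2 -mulrA; apply: le_trans (ler_wpM2l d1 step1) _.
  apply: (le_trans (y := PrS (fun w => site n.+1 w o i j) *
      PrS (fun w => site n.+1 w o (i + r).+1 j && has (X ^~ w) s))).
    by rewrite ler_wpM2r ?Pr_ge0 // sb.
  apply: le_trans (Pr_and_ge pr01 _ _ (ms _ _ _) _) _.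
    move=> w w' h /andP[h1 h2]; rewrite (ms _ _ _ _ _ h h1) /=.
    by apply: sub_has h2 => k; apply: mX.
  apply: Pr_le => // w; rewrite linkS /X.
  by rewrite (_ : ((i + r).+1 - i).+1 = r.+2) //; lia.
have d0 := defect_gt0 n.+1; have d1 := defect_le1 n.+1.
have a0 := amp_gt0 n.
have Lb : 10 ^+ 6 <= lr by [].
have Pr0 := Pr_ge0 pr01 S (fun w => has (X ^~ w) s) w0.
apply: target; set PH := PrS _ in Pall Pr0 *.
(* For [r = 0] the target [resist] is 1 and only [1 + defect n.+1] is available. The failure must
   then be quadratic in [amp n], which two independent lines provide. *)
have [r0|r0] := posnP r.
  have E0 : reduced_cost o n.+1 i r = 0%N by rewrite r0.
  have t1 : amp n * (2 ^+ 14 - 1) <= 1.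
    have := amp_tiny n; have : 1 <= lr ^+ 4 by rewrite exprn_ege1 // ler1n.
    move: (amp n) a0 => a a0 h4 ha; have : a * 1 <= a * lr ^+ 4 by rewrite ler_wpM2l // ltW.
    lra.
  have fail : \prod_(k <- s) (1 - PrS (X k)) <= (amp n * (2 ^+ 14 - 1)) ^+ 2.
    rewrite -(big_map (fun k => PrS (X k)) xpredT (fun P => 1 - P)).
    apply: prod_le_sqr => //.
      rewrite size_map -(ltr_nat R); apply: lt_le_trans szr; lra.
    move=> P /mapP[k /XP[/andP[P0 P1] +] ->]; rewrite E0 add0n => PT.
    have c0 : 0 <= amp n * (2 ^+ 14 - 1) by rewrite mulr_ge0 ?(ltW a0) //; lra.
    rewrite subr_ge0 P1 /=; move: (amp n * _) PT c0 => c; nra.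
  have fail8 : (amp n * (2 ^+ 14 - 1)) ^+ 2 <= defect n.+1 / 8.
    rewrite /defect ampS 3?ler_pdivlMr ?mulr_gt0 //.
    have := amp_tiny n; move: (amp n) a0 => a a0 ha.
    have L3 : 10 ^+ 6 * lr <= lr ^+ 4.
      rewrite (exprSr _ 3) ler_wpM2r ?ler0n // (le_trans Lb) // -[leLHS]expr1.
      by rewrite ler_weXn2l // ler1n.
    have {}L3 : a * (10 ^+ 6 * lr) <= a * lr ^+ 4 by rewrite ler_wpM2l // ltW.
    have {}L3 : a * lr * (2 ^+ 14 * 2 ^+ 14 * 512) <= 1 by lra.
    have := ler_wpM2l (ltW a0) L3.
    have : 0 <= a * a * lr by rewrite !mulr_ge0 // ltW.
    lra.
  rewrite E0 /resist expr0 subrr mulr0 addr0 mulr1.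
  have PH1 : 1 - defect n.+1 / 8 <= PH by rewrite Pall; lra.
  set d := defect n.+1 in d0 d1 PH1 *.
  apply: (le_trans (y := (1 - d / 8) ^+ 2 * ((1 - d / 8) * (1 + d)))).
    nra.
  rewrite ler_wpM2l ?sqr_ge0 // ler_wpM2r //; lra.
have E2 : (2 <= reduced_cost o n.+1 i r)%N.
  move: bad; rewrite /reduced_cost /all_bad; case: r r0 {vi' hcost X mX s XP sz szr Pall PH Pr0} => //= r _.
  by case: (v o n.+1 i.+1).
set E := reduced_cost o n.+1 i r in XP E2 *.
have X4 : 4 <= 2 ^+ E :> R.
  by rewrite (_ : 4 = 2 ^+ 2) ?ler_weXn2l ?ler1n //; ring.
have PHB : 1 <= PH * (1 + amp n.+1 * (2 ^+ E - 1)).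
  rewrite Pall -(big_map (fun k => PrS (X k)) xpredT (fun P => 1 - P)).
  (* The excess [2 ^+ 14] and the ratio 16 of the amplitudes make [2 ^+ 18]. This is outweighed by
     [size s], at least [10 ^+ 6 - 1], since [2 ^+ E - 1] is at least three quarters of [2 ^+ E]. *)
  apply: (@bernoulli_prod _ _ (amp n * (2 ^+ (E + 14) - 1))).
  - rewrite mulr_gt0 // subr_gt0 exprn_egt1 ?ltr1n // addn_eq0 andbF //.
  - rewrite size_map -(ltr_nat R); apply: lt_le_trans szr; lra.
  - by move=> P /mapP[k /XP h ->].
  rewrite size_map ampS exprD; move: (2 ^+ E) X4 => x x4.
  have h : (x - 1) * (10 ^+ 6 - 1) <= (x - 1) * (size s)%:R.
    by rewrite ler_wpM2l //; lra.
  have := ler_wpM2l (ltW a0) h.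
  have : amp n * 4 <= amp n * x by rewrite ler_wpM2l // ltW.
  move: (amp n) a0 => a a0; lra.
rewrite -/(resist n.+1 E) in PHB.
set d := defect n.+1 in d0 d1 *.
apply: (le_trans (y := (1 - d / 8) ^+ 2 * ((1 + d) * 1))); first nra.
rewrite ler_wpM2l ?sqr_ge0 // mulrCA ler_wpM2l //; lra.
Qed.
End CrossBound.

Lemma edges_bound o j len i :
  1 <= PrS (fun w => all (fun a => w (ed o a j)) (iota i len)) * (1 + defect 0) ^+ len.
Proof.
elim: len i => [|len IH] i; first by rewrite (Pr_sure pr01) // mul1r.
have d0 : 0 <= 1 + defect 0 by exact: addr_ge0 ler01 (ltW (defect_gt0 _)).
apply: (@Pr_and_lower (fun w => w (ed o i j)) _ (1 + defect 0) ((1 + defect 0) ^+ len)).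
- by move=> w w'; apply.
- by move=> w w' h; apply: sub_all => a; apply: h.
- exact: d0.
- exact: exprn_ge0.
- rewrite /Pr (ex_coord _ _ (fun b : bool => b%:R)) w0_ed mulr1 mulr0 addr0.
  (* An edge outside [S] is frozen open by [w0_ed]. *)
  case: ifP => _; first by rewrite /defect /amp expr0 divr1.
  by rewrite mul1r lerDl ltW // defect_gt0.
- exact: IH.
by rewrite exprS.
Qed.

Lemma cost_ge_size b ws : all (fun w => (0 < w)%N) ws -> (size ws <= cost b ws)%N.
Proof. by elim: ws b => [|[|w] ws IH] b //= h; have := IH true h; lia. Qed.

(** Of the [r + 1] edges to be open, one is paid by [1 + defect 0] and the other [r] by the cost of
    the [r] removed lines crossed. *)
Lemma link_bound0 : link_bound 0.
Proof.
move=> o i r j _ _ _ bad; have := edges_bound o j r.+1 i.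
rewrite /link /= (_ : ((i + r).+1 - i = r.+1)%N); last by lia.
move=> /le_trans; apply; rewrite ler_wpM2l ?Pr_ge0 // exprS.
have d0 : 0 <= 1 + defect 0 by exact: addr_ge0 ler01 (ltW (defect_gt0 _)).
rewrite ler_wpM2l //; apply: (le_trans (y := resist 0 1 ^+ r)).
  apply: lerXn2r; rewrite ?nnegrE ?(le_trans ler01 (resist_ge1 _ _)) //.
  rewrite /resist expr1 lerD2l (_ : 2 - 1 = 1) ?mulr1; last by ring.
  rewrite /defect ler_pdivrMr ?mulr_gt0 // ler_peMr ?(ltW (amp_gt0 _)) //.
  by have : 1 <= lr by [rewrite ler1n]; lra.
apply: le_trans (resist_exp _ _) (resist_mono _ _).
by have := cost_ge_size false bad; rewrite size_map size_iota.
Qed.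

Lemma site_link_bound n : site_bound n /\ link_bound n.
Proof.
elim: n => [|n [hs hl]].
  split; last exact: link_bound0.
  move=> o i j _ _; rewrite (Pr_sure pr01) // lerBlDr lerDl divr_ge0 //.
  exact: ltW (defect_gt0 _).
have hs' := site_step hs hl; split=> //; exact: link_step.
Qed.

Lemma cross_fail n o i j : v o n.+1 i = 0%N -> v (~~ o) n j = 0%N ->
  PrS (fun w => ~~ cross n w o (i * L) L j) <= 31 * amp n.
Proof.
by have [hs hl] := site_link_bound n; move=> vi vj; rewrite (PrC pr01) cross_block_fail.
Qed.
End Bounds.

(** * Connected sets of vertices *)

Section Connectivity.
Local Open Scope nat_scope.
Variables (K : eqType) (ed : bool -> nat -> nat -> K) (L : nat).
Variables (v : bool -> nat -> nat -> nat) (w : K -> bool).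
Variable conn : nat * nat -> nat * nat -> Prop.

Definition pt (o : bool) (a b : nat) : nat * nat := if o then (a, b) else (b, a).

Hypothesis L3 : 2 < L.
Hypothesis vS : forall o n i, v o n.+1 i = merge (map (v o n) (iota (i * L) L)).
Hypothesis conn_refl : forall x, conn x x.
Hypothesis conn_sym : forall x y, conn x y -> conn y x.
Hypothesis conn_trans : forall x y z, conn x y -> conn y z -> conn x z.
Hypothesis conn_edge : forall o a j, v (~~ o) 0 j = 0 -> w (ed o a j) ->
  conn (pt o a j) (pt o a.+1 j).

Local Notation site n := (site ed L v n w).
Local Notation link n := (link ed L v n w).
Local Notation cross n := (cross ed L v n w).
Local Notation goods := (goods v).

(* The well-connected part of the block (i, j): the cores of its sub-blocks
   lying on a crossed good line. *)
Fixpoint core n o i j (x : nat * nat) : Prop :=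
  if n is n'.+1 then
    exists k k', [/\ k \in goods (~~ o) n' (j * L) L, k' \in goods o n' (i * L) L,
      cross n' o (i * L) L k \/ cross n' (~~ o) (j * L) L k' & core n' o k' k x]
  else x = pt o i j.

Lemma core_sym n o i j x : core n (~~ o) j i x <-> core n o i j x.
Proof.
elim: n o i j => [|n IH] o i j /=; first by case: o.
by split=> -[k [k' [h1 h2 h3 h4]]]; exists k', k; rewrite ?negbK in h1 h2 h3 *;
  split=> //; [case: h3 => ?; [right|left]|apply/IH|case: h3 => ?; [right|left]|apply/IH].
Qed.

Definition joined (A B : nat * nat -> Prop) := forall x y, A x -> B y -> conn x y.

Lemma joined_sym A B : joined A B -> joined B A.
Proof. by move=> h x y hx hy; apply: conn_sym; apply: h. Qed.

Lemma joined_trans A B C : (exists x, B x) -> joined A B -> joined B C -> joined A C.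
Proof. by move=> [x Bx] h1 h2 y z Ay Cz; apply: conn_trans (h1 _ _ Ay Bx) (h2 _ _ Bx Cz). Qed.

Definition site_ok n := forall o i j, v o n i = 0 -> v (~~ o) n j = 0 -> site n o i j ->
  (exists x, core n o i j x) /\ joined (core n o i j) (core n o i j).
Definition link_ok n := forall o i i' j, i <= i' -> v o n i = 0 -> v o n i' = 0 ->
  v (~~ o) n j = 0 -> link n o i i' j -> joined (core n o i j) (core n o i' j).

Lemma cross_joined n o lo len j i i' : site_ok n -> link_ok n ->
  v (~~ o) n j = 0 -> cross n o lo len j ->
  i \in goods o n lo len -> i' \in goods o n lo len ->
  joined (core n o i j) (core n o i' j).
Proof.
move=> hs hl vj; rewrite crossE => /andP[/allP sites].
have good k : k \in goods o n lo len -> v o n k = 0.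
  by rewrite mem_goods => /andP[/eqP].
have := goods_lt_sorted v o n lo len.
move: (goods _ _ _ _) sites good => s sites good lts links.
have ok k : k \in s -> (exists x, core n o k j x) /\ joined (core n o k j) (core n o k j).
  by move=> ks; apply: hs (sites _ ks); rewrite ?good.
(* The first good block of the line serves as a hub. *)
suff [h [hh hj]] : exists h, (h \in s \/ s = [::]) /\
    forall k, k \in s -> joined (core n o h j) (core n o k j).
  case: hh => [hh|->] // hi hi'.
  apply: (@joined_trans _ (core n o h j)); [by have [] := ok h hh|exact/joined_sym/hj|exact: hj].
case: s lts links sites good ok => [|h s] /= lts links sites good ok.
  by exists 0; split; [right|].
exists h; split=> [|k]; first by left; rewrite mem_head.
have okh := ok h (mem_head _ _).
elim: s h lts links sites good ok okh => [|h' s IH] h /= lts links sites good ok okh.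
  by rewrite inE => /eqP ->; case: okh.
rewrite inE => /orP[/eqP ->|]; first by case: okh.
move: lts links => /andP[hh' lts] /andP[lk links].
have okh' : (exists x, core n o h' j x) /\ joined (core n o h' j) (core n o h' j).
  by apply: ok; rewrite !inE eqxx orbT.
move=> ks; apply: (@joined_trans _ (core n o h' j)); first by case: okh'.
  apply: hl lk => //; [exact: ltnW|apply: good; exact: mem_head|].
  by apply: good; rewrite !inE eqxx orbT.
by apply: IH => // k' hk'; [apply: sites|apply: good|apply: ok]; rewrite inE hk' orbT.
Qed.

Lemma at_most_one_fails_ex (X : nat -> bool) s : uniq s -> 1 < size s ->
  at_most_one_fails X s -> exists2 k, k \in s & X k.
Proof.
case: s => [|k [|k' s]] //= /andP[kn _] _ /allP /(_ k (mem_head _ _)) /allP /(_ k').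
rewrite !inE eqxx orbT => /(_ isT) /or3P[/eqP kk'|Xk|Xk'].
- by rewrite kk' inE eqxx in kn.
- by exists k; rewrite ?inE ?eqxx.
by exists k'; rewrite ?inE ?eqxx ?orbT.
Qed.

Lemma size_goods_block o n i : v o n.+1 i = 0 -> 1 < size (goods o n (i * L) L).
Proof.
move=> vi; have := count_good_block (ltnW L3) (vS o n) vi.
by rewrite -/(goods o n (i * L) L); lia.
Qed.

(** Some row [r] and some column [c] are crossed. A core point on a crossed row follows it to column
    [c], then [c] to row [r]; symmetrically for a crossed column. All of them reach [x0] in the core
    of [(c, r)]. *)
Lemma site_ok_step n : site_ok n -> link_ok n -> site_ok n.+1.
Proof.
move=> hs hl o i j vi vj; rewrite siteS => /andP[rows cols].
have [r rg Xr] := at_most_one_fails_ex (goods_uniq _ _ _ _ _) (size_goods_block vj) rows.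
have [c cg Xc] := at_most_one_fails_ex (goods_uniq _ _ _ _ _) (size_goods_block vi) cols.
have vg o' lo len k : k \in goods o' n lo len -> v o' n k = 0.
  by rewrite mem_goods => /andP[/eqP].
have row k a b : k \in goods (~~ o) n (j * L) L -> cross n o (i * L) L k ->
   a \in goods o n (i * L) L -> b \in goods o n (i * L) L ->
   joined (core n o a k) (core n o b k).
  by move=> hk hX ha hb; apply: cross_joined hX ha hb => //; apply: vg hk.
have col k a b : k \in goods o n (i * L) L -> cross n (~~ o) (j * L) L k ->
   a \in goods (~~ o) n (j * L) L -> b \in goods (~~ o) n (j * L) L ->
   joined (core n o k a) (core n o k b).
  move=> hk hX ha hb x y /core_sym hx /core_sym hy.
  by apply: (cross_joined hs hl _ hX ha hb) hx hy; rewrite negbK; apply: vg hk.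
have [[x0 hx0] _] : (exists x, core n o c r x) /\ joined (core n o c r) (core n o c r).
  apply: hs; [exact: vg cg|exact: vg rg|].
  by move: Xr; rewrite crossE => /andP[/allP + _]; apply.
have siteX k k' : k \in goods (~~ o) n (j * L) L -> k' \in goods o n (i * L) L ->
    cross n o (i * L) L k \/ cross n (~~ o) (j * L) L k' -> site n o k' k.
  move=> hk hk' [] ; rewrite crossE => /andP[/allP h _]; first exact: h.
  by rewrite -site_sym; apply: h.
have to_x0 x : core n.+1 o i j x -> conn x x0.
  move=> [k [k' [hk hk' hX hx]]].
  case: hX => hX.
    have [[y hy] _] : (exists y, core n o c k y) /\ joined (core n o c k) (core n o c k).
      by apply: hs; [exact: vg cg|exact: vg hk|apply: siteX => //; left].
    exact: conn_trans (row k k' c hk hX hk' cg _ _ hx hy) (col c k r cg Xc hk rg _ _ hy hx0).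
  have [[y hy] _] : (exists y, core n o k' r y) /\ joined (core n o k' r) (core n o k' r).
    by apply: hs; [exact: vg hk'|exact: vg rg|apply: siteX => //; left].
  exact: conn_trans (col k' k r hk' hX hk rg _ _ hx hy) (row r k' c rg Xr hk' cg _ _ hy hx0).
split; first by exists x0, r, c; split=> //; left.
by move=> x y hx hy; apply: conn_trans (to_x0 x hx) (conn_sym (to_x0 y hy)).
Qed.

Lemma cross_cat n o lo m1 m2 j : cross n o lo (m1 + m2) j ->
  cross n o lo m1 j /\ cross n o (lo + m1) m2 j.
Proof.
rewrite !crossE goodsD all_cat => /andP[/andP[h1 h2] /cat_sorted2 [h3 h4]].
by rewrite h1 h2 h3 h4.
Qed.

(** The restrictions of the long crossing to the two end blocks are crossings too, so it meets both
    cores. *)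
Lemma link_ok_step n : site_ok n -> link_ok n -> site_ok n.+1 -> link_ok n.+1.
Proof.
move=> hs hl hs' o i i' j ii' vi vi' vj; rewrite linkS => /and3P[si si' /hasP[k hk hX]].
have vk : v (~~ o) n k = 0 by move: hk; rewrite mem_goods => /andP[/eqP].
have h1 := hX; rewrite mulSn in h1; have [c1 _] := cross_cat h1.
have h2 := hX; rewrite mulSn addnC in h2; have [_ c2] := cross_cat h2.
have e2 : i * L + (i' - i) * L = i' * L by rewrite -mulnDl subnKC.
rewrite e2 in c2.
have ex_good i1 : v o n.+1 i1 = 0 -> exists a, a \in goods o n (i1 * L) L.
  move=> /size_goods_block; case: (goods _ _ _ _) => // a s _; exists a; exact: mem_head.
have [a ha] := ex_good i vi; have [a' ha'] := ex_good i' vi'.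
have vg lo len b : b \in goods o n lo len -> v o n b = 0.
  by rewrite mem_goods => /andP[/eqP].
have [[x hx] _] : (exists x, core n o a k x) /\ joined (core n o a k) (core n o a k).
  apply: hs => //; first exact: vg ha.
  by move: c1; rewrite crossE => /andP[/allP h _]; apply: h.
have [[y hy] _] : (exists x, core n o a' k x) /\ joined (core n o a' k) (core n o a' k).
  apply: hs => //; first exact: vg ha'.
  by move: c2; rewrite crossE => /andP[/allP h _]; apply: h.
have xI : core n.+1 o i j x by exists k, a; split=> //; left.
have yI : core n.+1 o i' j y by exists k, a'; split=> //; left.
have [_ ji] := hs' o i j vi vj si; have [_ ji'] := hs' o i' j vi' vj si'.
have xy : conn x y.
  apply: (cross_joined hs hl vk hX _ _ hx hy).
    by rewrite mulSn goodsD mem_cat ha.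
  by rewrite mulSn addnC goodsD mem_cat e2 ha' orbT.
by move=> p q hp hq; apply: conn_trans (ji _ _ hp xI) (conn_trans xy (ji' _ _ yI hq)).
Qed.

Lemma site_link_ok n : site_ok n /\ link_ok n.
Proof.
elim: n => [|n [hs hl]]; last first.
  by have hs' := site_ok_step hs hl; split=> //; apply: link_ok_step.
split=> [o i j _ _ _|o i i' j ii' _ _ vj].
  by split; [exists (pt o i j)|move=> x y -> ->].
move=> lk x y /= -> ->; move: (lk : all (fun a => w (ed o a j)) (iota i (i' - i))) => /allP {}lk.
rewrite -(subnKC ii'); elim: (i' - i) lk => [|m IH] lk; first by rewrite addn0.
apply: (conn_trans (y := pt o (i + m) j)).
  by apply: IH => a; rewrite mem_iota => ha; apply: lk; rewrite mem_iota; lia.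
by rewrite addnS; apply: conn_edge => //; apply: lk; rewrite mem_iota; lia.
Qed.

Lemma core_far n o i j x : core n o i j x -> i * L ^ n <= (if o then x.1 else x.2).
Proof.
elim: n i j => [|n IH] i j /=; first by move=> ->; rewrite expn0 muln1; case: o.
move=> [k [k' [_ + _ /IH]]]; rewrite mem_goods => /andP[_ /andP[h _]]; apply: leq_trans.
by rewrite expnS mulnA leq_mul2r h orbT.
Qed.

Lemma unbounded_cluster :
  (forall o n, v o n 0 = 0) -> (forall n, cross n true 0 L 0) ->
  forall n, exists2 x, conn (0, 0) x & n <= x.1.
Proof.
move=> v0 X n.
have g0 o m : 0 \in goods o m 0 L by rewrite mem_goods v0 /=; lia.
have origin m : core m true 0 0 (0, 0).
  elim: m => [|m IH] //=; exists 0, 0; split=> //; by left; apply: X.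
have [i hi i0] : exists2 i, i \in goods true n 0 L & 0 < i.
  have := size_goods_block (v0 true n.+1); rewrite mul0n.
  have := goods_uniq v true n 0 L.
  case: (goods _ _ _ _) => [|[|i] [|i' s]] //= /andP[ni _] _.
    exists i'; first by rewrite !inE eqxx orbT.
    by move: ni; rewrite inE negb_or eq_sym => /andP[+ _]; rewrite lt0n.
  by exists i.+1; rewrite // inE eqxx.
have [hs hl] := site_link_ok n.
have [[x hx] _] : (exists x, core n true i 0 x) /\ joined (core n true i 0) (core n true i 0).
  apply: hs; [by move: hi; rewrite mem_goods => /andP[/eqP]|exact: v0|].
  by have := X n; rewrite crossE => /andP[/allP + _]; apply.
exists x; first exact: (cross_joined hs hl (v0 _ _) (X n) (g0 _ _) hi) (origin n) hx.
have := core_far hx => /=; apply: leq_trans.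
apply: leq_trans (leq_pmull _ i0); apply: ltnW; apply: ltn_expl; lia.
Qed.

End Connectivity.

(** * Finite-dimensional events *)

Section FiniteDimensional.
Context {d : measure_display} {T : measurableType d} {R : realType}.
Variables (P : probability T R) (K : eqType) (X : K -> T -> bool) (pr : K -> R).
Hypothesis mX : forall k, measurable (X k @^-1` [set true]).
Hypothesis indepX : mutually_independent P X.
Hypothesis prX : forall k, P (X k @^-1` [set true]) = (pr k)%:E.

Definition cyl (A : seq K) (b : K -> bool) : set T := [set t | all (fun k => X k t == b k) A].

Let eqX k b : [set t | X k t = b] =
  if b then X k @^-1` [set true] else ~` (X k @^-1` [set true]).
Proof. by apply/seteqP; split=> t /=; case: b => /=; case: (X k t) => //= []. Qed.

Let meqX k b : measurable [set t | X k t = b].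
Proof. by rewrite eqX; case: b => //; apply: measurableC. Qed.

Let prob_eqX k (b : bool) : P [set t | X k t = b] = (if b then pr k else 1 - pr k)%:E.
Proof. by rewrite eqX; case: b; rewrite // probability_setC // prX. Qed.

Lemma measurable_cyl A b : measurable (cyl A b).
Proof.
elim: A => [|k A IH].
  by rewrite (_ : cyl _ _ = setT) //; apply/seteqP.
rewrite (_ : cyl _ _ = [set t | X k t = b k] `&` cyl A b); first exact: measurableI.
by apply/seteqP; split=> t; rewrite /cyl /=; [case/andP=> /eqP|case=> -> ->; rewrite eqxx].
Qed.

Definition weight (A : seq K) (b : K -> bool) : R :=
  \prod_(k <- A) (if b k then pr k else 1 - pr k).

Lemma prob_cyl A b : uniq A -> P (cyl A b) = (weight A b)%:E.
Proof.
move=> uA; rewrite /cyl indepX // /weight.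
elim: A {uA} => [|k A IH]; first by rewrite !big_nil.
by rewrite !big_cons IH prob_eqX EFinM.
Qed.

(** The coordinates of [S] move one by one into the cylinder; splitting on the value of [X k]
    mirrors the recursion defining [ex]. *)
Lemma prob_cyl_event (S A : seq K) (b : K -> bool) (e : (K -> bool) -> bool) :
  uniq (A ++ S) -> depends_on [in A ++ S] e ->
  measurable (cyl A b `&` [set t | e (X ^~ t)]) /\
  P (cyl A b `&` [set t | e (X ^~ t)]) = (weight A b * Pr pr S e b)%:E.
Proof.
elim: S A b => [|k S IH] A b.
  rewrite cats0 => uA de.
  have -> : cyl A b `&` [set t | e (X ^~ t)] = if e b then cyl A b else set0.
    have ee t : cyl A b t -> e (X ^~ t) = e b.
      by move=> /allP h; apply: de => k /h /eqP.
    apply/seteqP; split=> [t [] hc /=|t]; first by rewrite ee //; case: ifP.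
    by case: ifP => // eb hc; split=> //=; rewrite ee.
  rewrite /Pr /=; case: (e b); last by rewrite mulr0 measure0.
  by split; [exact: measurable_cyl|rewrite mulr1 prob_cyl].
move=> uA de.
have kA : k \notin A.
  by move: uA; rewrite cat_uniq => /and3P[_ + _]; rewrite /= negb_or => /andP[].
have pA : perm_eq (A ++ k :: S) ((k :: A) ++ S) by rewrite (perm_catCA A [:: k] S).
have uA' : uniq ((k :: A) ++ S) by rewrite -(perm_uniq pA).
have de' : depends_on [in (k :: A) ++ S] e.
  by move=> w w' h; apply: de => x /= hx; apply: h; rewrite /= -(perm_mem pA).
have cylk c : cyl (k :: A) (upd b k c) = cyl A b `&` [set t | X k t = c].
  have hA t : all (fun k' => X k' t == upd b k c k') A = all (fun k' => X k' t == b k') A.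
    apply: eq_in_all => k' hk'; rewrite upd_out //.
    by apply: contraNneq kA => <-.
  apply/seteqP; split=> t; rewrite /cyl /= hA /upd eqxx.
    by case/andP=> /eqP -> ->.
  by case=> -> ->; rewrite eqxx.
have wk c : weight (k :: A) (upd b k c) = (if c then pr k else 1 - pr k) * weight A b.
  rewrite /weight big_cons /upd eqxx; congr (_ * _); apply: eq_big_seq => k' hk'.
  by case: eqVneq => // E; rewrite -E hk' in kA.
have cylE : cyl A b `&` [set t | e (X ^~ t)] =
   (cyl (k :: A) (upd b k true) `&` [set t | e (X ^~ t)]) `|`
   (cyl (k :: A) (upd b k false) `&` [set t | e (X ^~ t)]).
  rewrite !cylk; apply/seteqP; split=> t /=.
    by move=> [h1 h2]; case E : (X k t); [left|right].
  by move=> [[[h1 _] h2]|[[h1 _] h2]].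
have [m1 P1] := IH (k :: A) (upd b k true) uA' de'.
have [m2 P2] := IH (k :: A) (upd b k false) uA' de'.
rewrite cylE; split; first exact: measurableU.
rewrite measureU //; last first.
  rewrite !cylk; apply/seteqP; split=> t //= [[[_ h1] _] [[_ h2] _]].
  by rewrite h1 in h2.
transitivity ((weight (k :: A) (upd b k true) * Pr pr S e (upd b k true))%:E +
  (weight (k :: A) (upd b k false) * Pr pr S e (upd b k false))%:E)%E.
  by congr (_ + _)%E; [exact: P1|exact: P2].
by rewrite !wk -EFinD /Pr /=; congr EFin; ring.
Qed.

Lemma prob_event (S : seq K) (e : (K -> bool) -> bool) w :
  uniq S -> depends_on [in S] e ->
  measurable [set t | e (X ^~ t)] /\ P [set t | e (X ^~ t)] = (Pr pr S e w)%:E.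
Proof.
move=> uS dS; have := @prob_cyl_event S [::] w e uS dS.
rewrite (_ : cyl _ _ = setT) ?setTI; last by apply/seteqP.
by rewrite /weight big_nil mul1r.
Qed.
End FiniteDimensional.

(** * The bad events *)

Section Assembly.

Definition edge (o : bool) (a b : nat) : idx :=
  if o then eh (Posz a, Posz b) else ev (Posz b, Posz a).

Definition is_edge (k : idx) : bool :=
  match k with
  | inr (inl (Posz _, Posz _)) | inr (inr (Posz _, Posz _)) => true
  | _ => false
  end.

Definition transversal (o : bool) (k : idx) : nat :=
  match k with
  | inr (inl u) | inr (inr u) => absz (if o then u.2 else u.1)
  | _ => 0%N
  end.

Lemma is_edge_edge o a b : is_edge (edge o a b).
Proof. by case: o. Qed.

Lemma transversal_edge o o' a b :
  transversal o (edge o' a b) = if o == o' then b else a.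
Proof. by case: o; case: o'. Qed.

(** Indexed by the direction in which the lines are numbered: removing a column leaves a defect
    along horizontal lines, so edges of direction [o] on line [j] obey [removal (~~ o) j]. *)
Definition removal (o : bool) (i : nat) : idx := if o then Defs.col (Posz i) else Defs.row (Posz i).

Lemma removal_inj o : injective (removal o).
Proof. by case: o => i j []. Qed.

Variable L : nat.

Definition env (w : idx -> bool) (o : bool) (n i : nat) : nat := wt L (w \o removal o) n i.

(** The weight at level [n.+1] appears because the crossed line spans block 0 of that level, which
    [cross_fail] requires to be good. *)
Definition bad_event n (w : idx -> bool) : bool :=
  [|| env w true n 0 != 0%N, env w false n 0 != 0%N, env w true n.+1 0 != 0%N |
      ~~ cross edge L (env w) n w true 0 L 0].

Definition env_seq n : seq idx :=
  undup ([seq removal true i | i <- iota 0 (L ^ n)] ++ [seq removal false i | i <- iota 0 (L ^ n)]).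
Definition edge_seq n : seq idx :=
  undup ([seq edge true a b | a <- iota 0 (L ^ n), b <- iota 0 (L ^ n)] ++
         [seq edge false b a | a <- iota 0 (L ^ n), b <- iota 0 (L ^ n)]).

Lemma env_seq_not_edge n k : k \in env_seq n -> is_edge k = false.
Proof. by rewrite mem_undup mem_cat => /orP[] /mapP[i _ ->]. Qed.

Lemma edge_seq_edge n k : k \in edge_seq n -> is_edge k.
Proof.
by rewrite mem_undup mem_cat => /orP[] /allpairsP[[a b] [_ _ ->]]; rewrite is_edge_edge.
Qed.

Lemma mem_edge_seq n k : is_edge k -> (transversal true k < L ^ n)%N ->
  (transversal false k < L ^ n)%N -> k \in edge_seq n.
Proof.
rewrite mem_undup mem_cat; case: k => [] // [] [[x|x] [y|y]] //= _ hy hx; apply/orP.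
  right; apply/allpairsP; exists (x, y); rewrite !mem_iota; split => //.
by left; apply/allpairsP; exists (x, y); rewrite !mem_iota; split.
Qed.

Lemma uniq_seqs n : uniq (env_seq n ++ edge_seq n).
Proof.
rewrite cat_uniq !undup_uniq andbT /=; apply/hasPn => k /edge_seq_edge hk.
by apply/negP => /env_seq_not_edge; rewrite hk.
Qed.

Hypothesis L_gt0 : (0 < L)%N.

Lemma same_env_ext w w' n : (forall k, k \in env_seq n -> w k = w' k) ->
  same_env L (L ^ n) (env w) (env w').
Proof.
move=> h o m i mn; apply: (wt_depends L_gt0) => k /hasP[a].
rewrite mem_iota => /andP[_ ha] /eqP ->; apply: h.
rewrite mem_undup mem_cat; apply/orP; case: o; [left|right];
  apply/mapP; exists a => //; rewrite mem_iota add0n /=; apply: leq_trans ha _;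
  by rewrite -mulSnr.
Qed.

Lemma bad_event_depends n :
  depends_on [in env_seq n.+1 ++ edge_seq n.+1] (bad_event n).
Proof.
move=> w w' h; have h1 k : k \in env_seq n.+1 -> w k = w' k.
  by move=> hk; apply: h; rewrite /= mem_cat hk.
have hE := same_env_ext h1.
have Ln : (L ^ n <= L ^ n.+1)%N by rewrite leq_pexp2l.
rewrite /bad_event !hE ?mul1n //; congr [|| _, _, _ | ~~ _].
apply: (cross_ext is_edge_edge transversal_edge L_gt0 hE); rewrite ?mul1n -?expnS //.
move=> x /and3P[xe /andP[_ x1] /andP[_ x2]]; apply: h; rewrite /= mem_cat mem_edge_seq ?orbT //.
  by apply: leq_trans x2 _; rewrite mul1n.
by move: x1; rewrite /= add0n expnS.
Qed.

Section BadProbability.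
Variables (R : realFieldType) (pr : idx -> R) (rho : R).
Hypothesis pr01 : forall k, 0 <= pr k <= 1.
Hypothesis L_big : 10 ^+ 6 <= L%:R :> R.
Hypothesis pr_removal : forall o i, pr (removal o i) = rho.
Hypothesis rho_small : rho <= L%:R ^- 16.
Hypothesis pr_edge : forall o a b, 1 - L%:R ^- 10 <= pr (edge o a b).

Lemma bad_event_prob n :
  Pr pr (env_seq n.+1 ++ edge_seq n.+1) (bad_event n) is_edge <= 2^-1 / (2 ^ n.+1)%:R.
Proof.
set S := _ ++ _; pose l : R := L%:R; have l6 : 10 ^+ 6 <= l by [].
have l0 : 0 < l by apply: lt_le_trans l6; rewrite exprn_gt0.
have [x xE] : {x : R | x = l^-1} by exists l^-1.
have x0 : 0 < x by rewrite xE invr_gt0.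
have lx : l * x = 1 by rewrite xE divff // gt_eqF.
have x6 : x <= 1 / 10 ^+ 6.
  by rewrite xE -div1r ler_pM2l // lef_pV2 ?posrE // exprn_gt0.
have x1 : x <= 1 by lra.
have xn m : x ^+ m.+1 <= x.
  by rewrite exprS; apply: ler_piMr; [exact: ltW|apply: exprn_ile1 => //; exact: ltW].
(* [eps] is [L^-16 z], a bound for [rho z]. [A0] is small enough for [A0 L^5 <= 1], yet
   [A0 / (4 L) = L^-9 / 4] dominates the closing probability, at most [L^-10]. *)
pose z := 4 * l; pose eps := 4 * x ^+ 15; pose A0 := x ^+ 8.
have moment o m i : ex pr S (fun w => zpow z (env w o m i)) is_edge <= eps / 2 ^+ m.
  apply: (moment_bound pr01 (@removal_inj o)) => //.
  - by rewrite /z; lra.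
  - move=> k; rewrite pr_removal.
    have -> : eps = x ^+ 16 * z.
      by rewrite -[eps]mulr1 -lx /eps /z; ring.
    rewrite ler_wpM2r //; first by rewrite mulr_ge0 // ltW.
    by rewrite xE exprVn.
  - by rewrite -/l /z mulrAC divff ?mul1r // pnatr_eq0.
  - rewrite -/l (_ : _ * eps = (l * x) ^+ 12 * (4 * 4 ^+ 10 * x ^+ 3)).
      rewrite lx expr1n mul1r.
      have : x ^+ 3 <= (1 / 10 ^+ 6) ^+ 3.
        by apply: lerXn2r => //; rewrite nnegrE; [exact: ltW|rewrite divr_ge0 // exprn_ge0].
      by lra.
    by rewrite /z /eps; ring.
  - by move=> k; case: o.
have A00 : 0 < A0 by rewrite exprn_gt0.
have quenched : Pr pr S (fun w => [&& env w true n.+1 0 == 0%N, env w false n 0 == 0%N &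
    ~~ cross edge L (env w) n w true 0 L 0]) is_edge <= 31 * amp A0 n.
  have amp0 : 0 <= 31 * amp A0 n by rewrite mulr_ge0 // ltW // amp_gt0.
  (* Conditioning on the environment: the edges are integrated with it frozen at [w1]. *)
  rewrite /Pr ex_cat -[leRHS](ex_cst pr (env_seq n.+1) _ is_edge).
  apply: ex_le_in => // w1 hw1.
  have w1e o a b : w1 (edge o a b).
    rewrite hw1 ?is_edge_edge //; apply/negP => /env_seq_not_edge.
    by rewrite is_edge_edge.
  have envE w2 : (forall k, k \notin edge_seq n.+1 -> w2 k = w1 k) -> env w2 = env w1.
    move=> hw2; apply/funext => o; apply/funext => m; apply/funext => i.
    apply: (wt_depends L_gt0) => k /hasP[a _ /eqP ->]; apply: hw2.
    by apply/negP => /edge_seq_edge; case: o.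
  rewrite (@ex_ext_in _ _ _ pr01 _ _ (fun w2 => ([&& env w1 true n.+1 0 == 0%N, env w1 false n 0 == 0%N &
    ~~ cross edge L (env w1) n w2 true 0 L 0])%:R)); last first.
    by move=> w2 /envE ->.
  case: eqP => [v1|_]; last by rewrite ex_cst.
  case: eqP => [v2|_]; last by rewrite ex_cst.
  apply: (@cross_fail _ _ _ edge L (env w1) is_edge transversal A0 pr01 is_edge_edge
    transversal_edge L_big A00 _ _ _ _ _ w1e n true 0 0) => //.
  - have -> : A0 * L%:R ^+ 5 = (l * x) ^+ 5 * x ^+ 3 by rewrite /A0 -/l; ring.
    by rewrite lx expr1n mul1r (le_trans (xn 2)).
  - move=> o a b; apply: (le_trans (y := (1 - x ^+ 10) * (1 + A0 / (4 * l)))).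
      have -> : A0 / (4 * l) = x ^+ 9 / 4.
        by rewrite invfM -xE /A0; field.
      have : x ^+ 10 <= x ^+ 9 / 10.
        rewrite (exprSr _ 9) ler_wpM2l ?exprn_ge0 ?ltW //; lra.
      have : 0 <= x ^+ 9 by rewrite exprn_ge0 // ltW.
      have : x ^+ 9 <= 1 := le_trans (xn 8) x1.
      move: (x ^+ 9) (x ^+ 10) => u w u1 u0 wu; nra.
    rewrite ler_wpM2r //; first by rewrite addr_ge0 // divr_ge0 ?mulr_ge0 ?ltW.
    by rewrite xE exprVn; apply: pr_edge.
(* Union bound, with Markov's inequality for the three weights. *)
apply: (le_trans (y := ex pr S (fun w => zpow z (env w true n 0) + (zpow z (env w false n 0) +
   (zpow z (env w true n.+1 0) + ([&& env w true n.+1 0 == 0%N, env w false n 0 == 0%N &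
    ~~ cross edge L (env w) n w true 0 L 0])%:R))) is_edge)).
  apply: ex_le => // w; rewrite /bad_event.
  have z1 : 1 <= z by rewrite /z; lra.
  have zge m : 0 <= zpow z m by rewrite zpow_ge0 // ltW // mulr_gt0.
  have zge1 m : m != 0%N -> 1 <= zpow z m by rewrite /zpow => /negbTE ->; rewrite exprn_ege1.
  have := zge (env w true n 0); have := zge (env w false n 0); have := zge (env w true n.+1 0).
  have h1 := zge1 (env w true n 0); have h2 := zge1 (env w false n 0).
  have h3 := zge1 (env w true n.+1 0).
  case: eqP h1 => [_ _|_ /(_ isT)]; case: eqP h2 => [_ _|_ /(_ isT)];
  case: eqP h3 => [_ _|_ /(_ isT)] //=; case: (cross edge L (env w) n w true 0 L 0) => /=; lra.
rewrite !exD; have m1 := moment true n 0%N; have m2 := moment false n 0%N.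
have m3 := moment true n.+1 0%N.
apply: le_trans (lerD m1 (lerD m2 (lerD m3 quenched))) _.
have pow16 : 2 ^+ n <= 16 ^+ n :> R by rewrite lerXn2r ?nnegrE //; lra.
have n2 : 0 < 2 ^+ n :> R by rewrite exprn_gt0.
have h16 : amp A0 n <= A0 / 2 ^+ n.
  by rewrite /amp ler_wpM2l ?(ltW A00) // lef_pV2 ?posrE ?exprn_gt0.
have A0s : A0 <= 1 / 10 ^+ 6.
  exact: le_trans (xn 7) x6.
have epss : eps <= 4 / 10 ^+ 6.
  have := xn 14.
  by rewrite /eps; lra.
rewrite natrX !exprS !invfM.
have y0 : 0 < (2 ^+ n)^-1 :> R by rewrite invr_gt0.
have e0 : 0 < eps by rewrite mulr_gt0 // exprn_gt0.
move: (2 ^+ n)^-1 y0 h16 => y y0 h16.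
have : eps * y <= 4 / 10 ^+ 6 * y by rewrite ler_wpM2r // ltW.
have : A0 * y <= 1 / 10 ^+ 6 * y by rewrite ler_wpM2r // ltW.
by lra.
Qed.

End BadProbability.
End Assembly.

(** * Percolation *)

Lemma infinite_cluster (Omega : Type) (X : idx -> Omega -> bool) (L : nat) (t : Omega) :
  (2 < L)%N -> (forall n, ~~ bad_event L n (X ^~ t)) -> conn_infty X t.
Proof.
move=> L3 good; pose w := X ^~ t; pose emb (u : nat * nat) : vertex := (Posz u.1, Posz u.2).
pose conn u u' := clos_refl_trans vertex (open_adj X t) (emb u) (emb u').
have v0 o n : env L w o n 0 = 0%N.
  have := good n; rewrite /bad_event -/w !negb_or !negbK => /and4P[/eqP h1 /eqP h2 _ _].
  by case: o.
have cr n : cross edge L (env L w) n w true 0 L 0.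
  by have := good n; rewrite /bad_event -/w !negb_or !negbK => /and4P[].
have adj_sym x y : open_adj X t x y -> open_adj X t y x.
  by move=> [h|[h|[h|h]]]; [right; left|left|do 3 right|right; right; left].
have unb : forall n, exists2 u, conn (0, 0)%N u & (n <= u.1)%N.
  apply: (@unbounded_cluster _ edge L (env L w) w conn L3) => //.
  - by move=> u; apply: rt_refl.
  - move=> u u'; rewrite /conn; elim=> [x y h|x|x y z _ h1 _ h2].
    + exact/rt_step/adj_sym.
    + exact: rt_refl.
    + exact: rt_trans h2 h1.
  - by move=> u u' u''; apply: rt_trans.
  move=> o a j hj hw; apply: rt_step.
  (* Weight 0 at level 0 means that the line carrying the edge is kept. *)
  have {}hj : w (removal (~~ o) j) = false by move: hj; rewrite /env /=; case: (w _).
  have aS : Posz a.+1 = (Posz a + 1)%R by rewrite -addn1 PoszD.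
  case: o hj hw => hj hw.
    by right; right; left; split; rewrite /emb /pt /= ?aS // /hopen -/(w _) hj.
  by left; split; rewrite /emb /pt /= ?aS // /vopen -/(w _) hj.
move=> /finite_seqP[s sE].
have [u hu] := unb (\max_(x <- s) `|x.1|%N).+1.
have : emb u \in s by have := hu : open_cluster X t (emb u); rewrite sE.
by move=> us; rewrite ltnNge (@leq_bigmax_seq _ s xpredT (fun x : vertex => `|x.1|%N) (emb u)).
Qed.

Theorem theorem1p1 (d : measure_display) (T : measurableType d) (R : realType)
  (P : probability T R) (rho p : R) (X : idx -> T -> bool) :
  0 <= rho -> rho < 1 -> 0 <= p -> p <= 1 ->
  rho <= bigL ^- 16 ->
  p >= (1 - bigL ^- 10) `^ (4^-1) ->
  annealed_model P rho p X ->
  exists A : set T, [/\ measurable A, A `<=` conn_infty X & (0 < P A)%E].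
Proof.
move=> rho0 rho1 p0 p1 rhoL pL [mX indepX [Pcol Prow Pev Peh]].
have [L LE] : exists L : nat, L%:R = bigL :> R by exists (10 ^ 6)%N; rewrite natrX.
have L6 : 10 ^+ 6 <= L%:R :> R by rewrite LE.
have L3 : (2 < L)%N.
  rewrite -(ltr_nat R); apply: lt_le_trans L6; lra.
pose pr (k : idx) : R := if k is inl _ then rho else p.
have prX k : P (X k @^-1` [set true]) = (pr k)%:E.
  by case: k => [[i|j]|[v|v]]; [exact: Pcol|exact: Prow|exact: Pev|exact: Peh].
have pr01 k : 0 <= pr k <= 1.
  by case: k => k /=; rewrite ?p0 ?p1 // rho0 ltW.
have p_lower : 1 - L%:R ^- 10 <= p.
  (* A number in [(0, 1]] is at most its fourth root. *)
  apply: le_trans pL; rewrite LE; apply: ger1_powR; last lra.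
  have b1 : 1 < bigL ^+ 10 :> R by rewrite -LE exprn_egt1 // ltr1n ltnW.
  have b0 : 0 < bigL ^+ 10 :> R := lt_trans ltr01 b1.
  rewrite subr_gt0 invf_lt1 // b1 /= gerBl invr_ge0 ltW //.
pose bad n := [set t | bad_event L n (X ^~ t)].
have badP n : measurable (bad n) /\ (P (bad n) <= (2^-1 / (2 ^ n.+1)%:R)%:E)%E.
  have [m ->] := prob_event mX indepX prX is_edge (uniq_seqs L n.+1)
    (@bad_event_depends L (ltnW (ltnW L3)) n).
  split=> //; rewrite lee_fin; apply: (@bad_event_prob L _ _ pr rho) => //.
  - exact: ltnW (ltnW L3).
  - by case.
  - by rewrite LE.
  - by case.
have mU : measurable (\bigcup_n bad n) by apply: bigcup_measurable => n _; case: (badP n).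
exists (~` \bigcup_n bad n); split.
- exact: measurableC.
- move=> t /= nt; apply: (@infinite_cluster _ X L) => // n.
  by apply/negP => h; apply: nt; exists n.
(* The bounds on the bad events sum to [2^-1], so their union has probability less than 1. *)
rewrite probability_setC // sube_gt0.
apply: (@le_lt_trans _ _ (2^-1)%:E); last by rewrite lte_fin; lra.
apply: (le_trans (measure_sigma_subadditive P _ mU (@subset_refl _ _))).
  by move=> n; case: (badP n).
have half : 0 <= 2^-1 :> R by lra.
apply: le_trans (epsilon_trick0 xpredT half).
by apply: lee_nneseries => n _ //; case: (badP n).
Qed.
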